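(* Let $m\in\mathbb{N}$, let $(\Omega,\mu)$ be a $\sigma$-finite measure space and let $(\{f_\alpha\}_{\alpha\in\Omega},\{\tau_\alpha\}_{\alpha\in\Omega})$ be a continuous Bessel family for a finite dimensional Banach space $\mathcal{X}$ over $\mathbb{K}$ of dimension $d$. If the diagonal $\Delta:=\{(\alpha,\alpha):\alpha\in\Omega\}$ is measurable in the measure space $\Omega\times\Omega$, $$\int_{\Omega\times\Omega}|f_\alpha(\tau_\beta)f_\beta(\tau_\alpha)|^m\,d(\mu\times\mu)(\alpha,\beta)<\infty,$$ and the operator $$S_{f,\tau}:\mathrm{Sym}^m(\mathcal{X})\ni x\mapsto\int_\Omega f_\alpha^{\otimes m}(x)\,\tau_\alpha^{\otimes m}\,d\mu(\alpha)\in\mathrm{Sym}^m(\mathcal{X})$$ is diagonalizable and its eigenvalues are all nonnegative, then $$\int_{\Omega\times\Omega}f_\alpha(\tau_\beta)^mf_\beta(\tau_\alpha)^m\,d(\mu\times\mu)(\alpha,\beta)=\int_\Omega\int_\Omega f_\alpha(\tau_\beta)^mf_\beta(\tau_\alpha)^m\,d\mu(\alpha)\,d\mu(\beta)$$ $$\geq\ \frac{1}{\binom{d+m-1}{m}}\left(\int_\Omega f_\alpha(\tau_\alpha)^m\,d\mu(\alpha)\right)^2=\frac{1}{\dim(\mathrm{Sym}^m(\mathcal{X}))}\left(\int_\Omega f_\alpha(\tau_\alpha)^m\,d\mu(\alpha)\right)^2 \qquad ( * )$$ and $$\sup_{\alpha,\beta\in\Omega,\ \alpha\neq\beta}|f_\alpha(\tau_\beta)f_\beta(\tau_\alpha)|^m\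 \geq\ \frac{\frac{1}{\binom{d+m-1}{m}}\left(\int_\Omega f_\alpha(\tau_\alpha)^m\,d\mu(\alpha)\right)^2-\int_\Delta|f_\alpha(\tau_\alpha)|^{2m}\,d(\mu\times\mu)(\alpha,\alpha)}{(\mu\times\mu)((\Omega\times\Omega)\setminus\Delta)},$$ $$\sup_{\alpha,\beta\in\Omega,\ \alpha\neq\beta}|f_\alpha(\tau_\beta)|^m\ \geq\ \sqrt{\frac{\frac{1}{\binom{d+m-1}{m}}\left(\int_\Omega f_\alpha(\tau_\alpha)^m\,d\mu(\alpha)\right)^2-\int_\Delta|f_\alpha(\tau_\alpha)|^{2m}\,d(\mu\times\mu)(\alpha,\alpha)}{(\mu\times\mu)((\Omega\times\Omega)\setminus\Delta)}}.$$ Further, equality holds in $( * )$ if and only if $(\{f_\alpha^{\otimes m}\}_{\alpha\in\Omega},\{\tau_\alpha^{\otimes m}\}_{\alpha\in\Omega})$ is a tight continuous ASF for $\mathrm{Sym}^m(\mathcal{X})$. In particular, if $f_\alpha(\tau_\alpha)=1$ for all $\alpha\in\Omega$, then $$\sup_{\alpha,\beta\in\Omega,\ \alpha\neq\beta}|f_\alpha(\tau_\beta)f_\beta(\tau_\alpha)|^m\ \geq\ \frac{1}{(\mu\times\mu)((\Omega\times\Omega)\setminus\Delta)}\left[\frac{\mu(\Omega)^2}{\binom{d+m-1}{m}}-(\mu\times\mu)(\Delta)\right]$$ and $$\sup_{\alpha,\beta\in\Omega,\ \alpha\neq\beta}|f_\alpha(\tau_\beta)|^m\ \geq\ \sqrt{\frac{1}{(\mu\times\mu)((\Omega\times\Omega)\setminus\Delta)}\left[\frac{\mu(\Omega)^2}{\binom{d+m-1}{m}}-(\mu\times\mu)(\Delta)\right]}.$$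 In all these bounds $\binom{d+m-1}{m}=\dim(\mathrm{Sym}^m(\mathcal{X}))$.
   Context: $\mathbb{K}$ is $\mathbb{R}$ or $\mathbb{C}$; $\mathcal{X}^*$ is the dual of $\mathcal{X}$. An operator on a finite dimensional space is diagonalizable if the space has a basis of eigenvectors of it. Let $V$ be a finite dimensional Banach space, $\{\omega_\alpha\}_{\alpha\in\Omega}$ a collection in $V$, $\{g_\alpha\}_{\alpha\in\Omega}$ a collection in $V^*$. The pair $(\{g_\alpha\}_{\alpha\in\Omega},\{\omega_\alpha\}_{\alpha\in\Omega})$ is a continuous approximate Bessel family (for short, continuous Bessel family) for $V$ if (i) for every $x\in V$ and $\phi\in V^*$ the map $\Omega\ni\alpha\mapsto g_\alpha(x)\phi(\omega_\alpha)\in\mathbb{K}$ is measurable and integrable, and (ii) the frame operator $S_{g,\omega}:V\ni x\mapsto\int_\Omega g_\alpha(x)\omega_\alpha\,d\mu(\alpha)\in V$ (weak/Pettis integral) is a well-defined bounded linear operator. It is a continuous approximate Schauder frame (continuous ASF) if moreover $S_{g,\omega}$ is invertible, and a tight continuous ASF if $S_{g,\omega}=\lambda I_V$ for some nonzero scalar $\lambda$, where $I_V$ is the identity operator on $V$. $\mathrm{Sym}^m(\mathcal{X})\subseteq\mathcal{X}^{\otimes m}$ is the Banach space of symmetric $m$-tensors. For $\tau\in\mathcal{X}$, $\tau^{\otimes m}=\tau\otimes\cdots\otimes\tau$ ($m$ factors); for $f\in\mathcal{X}^*$, $f^{\otimes m}$ is the functional determined by $f^{\otimes m}(x_1\otimes\cdots\otimes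 x_m)=f(x_1)\cdots f(x_m)$, restricted to $\mathrm{Sym}^m(\mathcal{X})$. $\int_\Delta|f_\alpha(\tau_\alpha)|^{2m}\,d(\mu\times\mu)(\alpha,\alpha)$ denotes the integral over $\Delta$, with respect to $\mu\times\mu$, of the function taking the value $|f_\alpha(\tau_\alpha)|^{2m}$ at $(\alpha,\alpha)$.
   Formalization: The equivalence between equality in ( * ) and tightness is stated only when the operator S on Sym^m(X) is not zero; if all f_α = 0 then equality 0 = 0 holds, yet S = 0 is not λI with λ nonzero. *)

(* Defs.v *)
From HB Require Import structures.
From mathcomp Require Import all_boot all_order all_algebra all_fingroup.
From mathcomp Require Import all_classical all_reals all_analysis.
From mathcomp Require Import complex.

Set Implicit Arguments.
Unset Strict Implicit.
Unset Printing Implicit Defensive.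

Import Order.TTheory GRing.Theory Num.Theory.
Import numFieldNormedType.Exports.

Local Open Scope classical_set_scope.
Local Open Scope ring_scope.

(* Finite dimensional normed spaces (automatically complete over R and C) and
   finite dimensional Banach spaces over K. *)
#[short(type="finNormedModType")]
HB.structure Definition FinNormedModule (K : numFieldType) :=
  {V of NormedModule K V & Vector K V}.

#[short(type="finBanachType")]
HB.structure Definition FinBanach (K : numFieldType) :=
  {V of FinNormedModule K V & Complete V}.

Variant scalar_kind := RealScalars | ComplexScalars.

Definition scalars (R : realType) (k : scalar_kind) : numFieldType :=
  match k with RealScalars => R | ComplexScalars => R[i] end.

Section Scalars.
Variables (R : realType) (k : scalar_kind).

Definition scalar_re : scalars R k -> R :=
  match k return scalars R k -> R with
  | RealScalars => fun z => z
  | ComplexScalars => fun z => complex.Re z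
  end.

Definition scalar_im : scalars R k -> R :=
  match k return scalars R k -> R with
  | RealScalars => fun=> 0
  | ComplexScalars => fun z => complex.Im z
  end.

(* a + ib; the imaginary part is discarded for real scalars. *)
Definition mkscalar (a b : R) : scalars R k :=
  match k return scalars R k with
  | RealScalars => a
  | ComplexScalars => Complex a b
  end.

(* The library norm `|z| is an element of the field of scalars; this is the
   corresponding real number. *)
Definition modulus (z : scalars R k) : R := scalar_re `|z|.

Lemma mkscalar_le (a b : R) : (mkscalar a 0 <= mkscalar b 0) = (a <= b).
Proof. by rewrite /mkscalar; case: k => //=; rewrite lecE/= eqxx. Qed.

Lemma mkscalarD (a b : R) : mkscalar (a + b) 0 = mkscalar a 0 + mkscalar b 0.
Proof. by rewrite /mkscalar; case: k => //=; rewrite /GRing.add/= addr0. Qed.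

Lemma mkscalarM (a b : R) : mkscalar (a * b) 0 = mkscalar a 0 * mkscalar b 0.
Proof.
rewrite /mkscalar; case: k => //=.
by rewrite {2}/GRing.mul/= !(mulr0, mul0r) subr0 addr0.
Qed.

Lemma mkscalar0 : mkscalar 0 0 = 0.
Proof. by rewrite /mkscalar; case: k. Qed.

Lemma modulusE (z : scalars R k) : mkscalar (modulus z) 0 = `|z|.
Proof. by rewrite /modulus /mkscalar /scalar_re; case: k z => [z//|[a b]]/=. Qed.

End Scalars.

(* The dual V^*: continuous linear functionals. *)
Record dual_space (K : numFieldType) (V : normedModType K) := Dual {
  dual_fun :> {linear V -> K^o};
  dual_continuous : continuous dual_fun }.

Section MultilinearForms.
Variables (K : numFieldType) (X : normedModType K) (m : nat).

(* Bounded m-linear forms on X; [dfwith x i u] is x with its i-th entry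
   replaced by u. *)
Record mform := MForm {
  mform_fun :> ('I_m -> X) -> K;
  mform_linear : forall (x : 'I_m -> X) i a (u v : X),
    mform_fun (dfwith x i (a *: u + v)) =
    a * mform_fun (dfwith x i u) + mform_fun (dfwith x i v);
  mform_bounded :
    exists M, forall x : 'I_m -> X, `|mform_fun x| <= M * \prod_i `|x i| }.

Lemma mform_eq (A B : mform) : A =1 B -> A = B.
Proof.
case: A B => [f f1 f2] [g g1 g2] /= /funext fg; subst g.
by rewrite (Prop_irrelevance f1 g1) (Prop_irrelevance f2 g2).
Qed.

Lemma dfwith_perm (x : 'I_m -> X) (i : 'I_m) (u : X) (s : 'S_m) :
  dfwith x i u \o s = dfwith (x \o s) ((s^-1)%g i) u.
Proof.
apply/funext => j /=; have [<-|ij] := eqVneq ((s^-1)%g i) j.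
  by rewrite permKV !dfwithin.
rewrite !dfwithout //; apply: contra_neq ij => ->.
by rewrite permK.
Qed.

Fact permf_linear (A : mform) (s : 'S_m) (x : 'I_m -> X) i a (u v : X) :
  A (dfwith x i (a *: u + v) \o s) =
  a * A (dfwith x i u \o s) + A (dfwith x i v \o s).
Proof. by rewrite !dfwith_perm mform_linear. Qed.

Fact permf_bounded (A : mform) (s : 'S_m) :
  exists M, forall x : 'I_m -> X, `|A (x \o s)| <= M * \prod_i `|x i|.
Proof.
have [M HM] := mform_bounded A; exists M => x.
apply: (le_trans (HM _)); rewrite [X in _ <= _ * X](reindex_inj (@perm_inj _ s)).
exact: lexx.
Qed.

Definition permf (A : mform) (s : 'S_m) : mform :=
  MForm (permf_linear A s) (permf_bounded A s).

Fact scalef_linear (c : K) (A : mform) (x : 'I_m -> X) i a (u v : X) :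
  c * A (dfwith x i (a *: u + v)) =
  a * (c * A (dfwith x i u)) + c * A (dfwith x i v).
Proof. by rewrite mform_linear mulrDr mulrCA. Qed.

Fact scalef_bounded (c : K) (A : mform) :
  exists M, forall x : 'I_m -> X, `|c * A x| <= M * \prod_i `|x i|.
Proof.
have [M HM] := mform_bounded A; exists (`|c| * M) => x.
by rewrite normrM -mulrA ler_wpM2l.
Qed.

Definition scalef (c : K) (A : mform) : mform :=
  MForm (scalef_linear c A) (scalef_bounded c A).

Fact powf_linear (f : dual_space X) (x : 'I_m -> X) i a (u v : X) :
  \prod_j f (dfwith x i (a *: u + v) j) =
  a * \prod_j f (dfwith x i u j) + \prod_j f (dfwith x i v j).
Proof.
have E w : \prod_j f (dfwith x i w j) = f w * \prod_(j | j != i) f (x j).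
  rewrite (bigD1 i) //= dfwithin; congr (_ * _); apply: eq_bigr => j ji.
  by rewrite dfwithout // eq_sym.
by rewrite !E linearP mulrDl mulrA.
Qed.

Fact dual_bound (f : dual_space X) : exists2 M : K, 0 < M & forall x, `|f x| <= M * `|x|.
Proof.
have /linear_bounded_continuous/linear_boundedP := @dual_continuous _ _ f.
by move=> /pinfty_ex_gt0[M M0 HM]; exists M.
Qed.

Fact powf_bounded (f : dual_space X) :
  exists M, forall x : 'I_m -> X, `|\prod_i f (x i)| <= M * \prod_i `|x i|.
Proof.
have [M _ HM] := dual_bound f; exists (\prod_(i < m) M) => x.
rewrite -big_split normr_prod; apply: ler_prod => i _.
by rewrite normr_ge0 HM.
Qed.

(* The m-linear form (x_1, ..., x_m) |-> f(x_1) ... f(x_m). *)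
Definition powf (f : dual_space X) : mform :=
  MForm (powf_linear f) (powf_bounded f).

End MultilinearForms.

Section FiniteSpan.
Variables (F : fieldType) (L W : lmodType F) (f : L -> W) (N : nat).
Variable (w : 'I_N -> W).
Hypothesis f_linear : linear f.
Hypothesis f_inj : injective f.
Hypothesis f_span : forall u, exists c : 'rV[F]_N, f u = \sum_j c 0 j *: w j.

Let free_fam n (e : 'I_n -> L) : Prop :=
  forall c : 'rV[F]_n, \sum_i c 0 i *: e i = 0 -> c = 0.

Let has_free n : bool := `[< exists e : 'I_n -> L, free_fam e >].

Lemma finite_span_coordinates :
  exists n (v2r : L -> 'rV[F]_n), linear v2r /\ bijective v2r.
Proof.
pose fL := HB.pack_for {linear L -> W} f (GRing.isLinear.Build _ _ _ _ f f_linear).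
have f0 : f 0 = 0 := raddf0 fL.
have ex0 : exists n, has_free n.
  exists 0%N; apply/asboolP; exists (fun=> 0) => c _.
  by apply/rowP => -[].
have bnd n : has_free n -> (n <= N)%N.
  move=> /asboolP[e fe]; rewrite leqNgt; apply/negP => Nn.
  have [M HM] := choice (fun i => f_span (e i)).
  pose A := \matrix_(i < n, j < N) M i 0 j.
  have : ~~ row_free A.
    by rewrite /row_free neq_ltn (leq_ltn_trans (rank_leq_col A)).
  rewrite -kermx_eq0 => /rowV0Pn[v /sub_kermxP vA v0].
  case/negP: v0; apply/eqP; apply: fe; apply: f_inj.
  rewrite -[f]/(fL : L -> W) linear_sum raddf0.
  under eq_bigr => i _ do rewrite linearZ /= HM scaler_sumr.
  rewrite exchange_big /= big1 // => j _.
  under eq_bigr => i _ do rewrite scalerA.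
  rewrite -scaler_suml (_ : \sum_i _ = 0) ?scale0r //.
  have /matrixP/(_ 0 j) := vA; rewrite !mxE => vA0; rewrite -[RHS]vA0.
  by apply: eq_bigr => i _; rewrite mxE.
have [n /asboolP[e fe] nmax] := ex_maxnP ex0 bnd.
have spanE u : exists c : 'rV[F]_n, u = \sum_i c 0 i *: e i.
  apply: contrapT => nu; have : has_free n.+1; last by move/nmax; rewrite ltnn.
  apply/asboolP; exists (fun i => match unlift ord_max i with Some j => e j | None => u end).
  move=> c; rewrite big_ord_recr /= unlift_none.
  rewrite (eq_bigr (fun i => c 0 (lift ord_max i) *: e i)); last first.
    move=> i _; rewrite (_ : widen_ord _ i = lift ord_max i) ?liftK //.
    by apply: val_inj; rewrite /= /bump leqNgt ltn_ord.
  move=> H; have c0 : c 0 ord_max = 0.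
    apply: contrapT => /eqP c0; apply: nu.
    exists (\row_i (- (c 0 ord_max)^-1 * c 0 (lift ord_max i))).
    under eq_bigr => i _ do rewrite mxE -scalerA.
    rewrite -scaler_sumr; move/eqP: H; rewrite addr_eq0 => /eqP ->.
    by rewrite scalerN scaleNr opprK scalerA mulVf // scale1r.
  move: H; rewrite c0 scale0r addr0 => H.
  have {}H : \row_i c 0 (lift ord_max i) = 0 :> 'rV[F]_n.
    by apply: fe; rewrite -[RHS]H; apply: eq_bigr => i _; rewrite mxE.
  apply/rowP => i; rewrite mxE; case: (unliftP ord_max i) => [j ->|->] //.
  by have /rowP/(_ j) := H; rewrite !mxE.
have [co coE] := choice spanE.
exists n, co; split.
  move=> a u v; apply/eqP; rewrite -subr_eq0; apply/eqP; apply: fe.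
  under eq_bigr => i _ do rewrite !mxE scalerBl scalerDl -scalerA.
  rewrite sumrB big_split /= -scaler_sumr -!coE; exact: subrr.
exists (fun c : 'rV[F]_n => \sum_i c 0 i *: e i) => [u|c]; first by rewrite -coE.
apply/eqP; rewrite -subr_eq0; apply/eqP; apply: fe.
under eq_bigr => i _ do rewrite !mxE scalerBl.
rewrite sumrB -coE; exact: subrr.
Qed.

Definition finite_span_dim : nat := sval (cid finite_span_coordinates).

Definition finite_span_axiom : Vector.axiom finite_span_dim L :=
  let: exist v2r (conj v2r_linear v2r_bij) :=
    cid (svalP (cid finite_span_coordinates)) in
  exist2 _ _ v2r v2r_linear v2r_bij.

End FiniteSpan.

Section SymmetricTensors.
Variables (R : realType) (k : scalar_kind).
Local Notation K := (scalars R k).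
Variables (X : finNormedModType K) (m : nat).
Local Notation form := (mform X m).

(* X^{\otimes m} is realized as the span, inside the functionals on the m-linear
   forms of X, of the elementary tensors A |-> A (x_1, ..., x_m). All m-linear
   forms on a finite dimensional space are bounded, so this is the algebraic
   tensor power. *)
Definition elementary (x : 'I_m -> X) : form -> K^o := fun A => A x.

Definition is_tensor (u : form -> K^o) : Prop :=
  exists n (c : 'I_n -> K) (x : 'I_n -> 'I_m -> X),
    u = \sum_(i < n) c i *: elementary (x i).

Definition is_symmetric (u : form -> K^o) : Prop :=
  forall (s : 'S_m) (A : form), u (permf A s) = u A.

Definition sym_pred : {pred form -> K^o} :=
  fun u => `[< is_tensor u /\ is_symmetric u >].

Lemma is_tensor_scale (c : K) (u : form -> K^o) (A : form) :
  is_tensor u -> u (scalef c A) = c * u A.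
Proof.
move=> [n [a [x ->]]]; rewrite !fct_sumE mulr_sumr.
by apply: eq_bigr => i _; rewrite mulrCA.
Qed.

Lemma is_tensorP (c : K) u v :
  is_tensor u -> is_tensor v -> is_tensor (c *: u + v).
Proof.
move=> [n [a [x ->]]] [p [b [y ->]]]; exists (n + p)%N.
exists (fun i => match fintype.split i with inl j => c * a j | inr j => b j end).
exists (fun i => match fintype.split i with inl j => x j | inr j => y j end).
rewrite big_split_ord /= scaler_sumr; congr (_ + _); apply: eq_bigr => i _.
  by rewrite -[lshift _ _]/(unsplit (inl _)) unsplitK scalerA.
by rewrite -[rshift _ _]/(unsplit (inr _)) unsplitK.
Qed.

Fact sym_pred_closed : submod_closed sym_pred.
Proof.
split=> [|c u v /asboolP[tu su] /asboolP[tv sv]]; apply/asboolP; split.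
- by exists 0%N, (fun=> 0), (fun _ _ => 0); rewrite big_ord0.
- by [].
- exact: is_tensorP.
- by move=> s A; rewrite !fctE su sv.
Qed.

HB.instance Definition _ :=
  GRing.isSubmodClosed.Build K (form -> K^o) sym_pred sym_pred_closed.

(* Sym^m(X), with the projective norm
   |u| = sup { |u(A)| : A an m-linear form, |A(x)| <= |x_1| ... |x_m| }. *)
Record sym_tensors := Sym { sym_val :> form -> K^o; sym_valP : sym_val \in sym_pred }.

HB.instance Definition _ := [isSub for sym_val].
HB.instance Definition _ := [Choice of sym_tensors by <:].
HB.instance Definition _ := [SubChoice_isSubLmodule of sym_tensors by <:].

Definition contractive (A : form) : Prop := forall x, `|A x| <= \prod_i `|x i|.

Definition sym_norm_set (u : sym_tensors) : set R :=
  [set modulus (u A) | A in contractive].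

Definition sym_norm (u : sym_tensors) : K := mkscalar k (sup (sym_norm_set u)) 0.

Lemma sym_tensor (u : sym_tensors) : is_tensor u.
Proof. by case/asboolP: (sym_valP u). Qed.

Fact zerof_linear (x : 'I_m -> X) (i : 'I_m) (a : K) (u v : X) :
  0 = a * 0 + 0 :> K.
Proof. by rewrite mulr0 addr0. Qed.

Fact zerof_bounded : exists M, forall x : 'I_m -> X, `|0 : K| <= M * \prod_i `|x i|.
Proof. by exists 0 => x; rewrite normr0 mul0r. Qed.

Definition zerof : form := MForm zerof_linear zerof_bounded.

Lemma modulus_ge0 (z : K) : 0 <= modulus z.
Proof. by rewrite -(mkscalar_le k) modulusE mkscalar0. Qed.

Lemma sym_norm_ub (u : sym_tensors) : exists M : R, ubound (sym_norm_set u) M.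
Proof.
have [n [a [x ux]]] := sym_tensor u.
pose N := \sum_(i < n) `|a i| * \prod_j `|x i j|.
have N0 : 0 <= N by apply: sumr_ge0 => i _; rewrite mulr_ge0// prodr_ge0.
exists (scalar_re N) => _ [A cA <-].
rewrite -(mkscalar_le k) modulusE -[scalar_re N]/(scalar_re N) -(ger0_norm N0) -/(modulus N).
rewrite modulusE (ger0_norm N0) ux fct_sumE (le_trans (ler_norm_sum _ _ _))//.
by apply: ler_sum => i _; rewrite normrM; apply: ler_wpM2l => //; exact: cA.
Qed.

Lemma sym_norm_has_sup (u : sym_tensors) : has_sup (sym_norm_set u).
Proof.
split; last exact: sym_norm_ub.
exists (modulus (u zerof)), zerof => // x.
by rewrite normr0 prodr_ge0.
Qed.

Lemma sym_le_norm (u : sym_tensors) (A : form) : contractive A -> `|u A| <= sym_norm u.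
Proof.
move=> cA; rewrite -modulusE mkscalar_le.
apply: ub_le_sup; first exact: sym_norm_ub.
by exists A.
Qed.

Lemma sym_norm_le (u : sym_tensors) (M : R) :
  (forall A, contractive A -> modulus (u A) <= M) ->
  sym_norm u <= mkscalar k M 0.
Proof.
move=> uM; rewrite mkscalar_le; apply: ge_sup.
  by have [] := sym_norm_has_sup u.
by move=> _ [A cA <-]; exact: uM.
Qed.

Fact sym_normD (u v : sym_tensors) : sym_norm (u + v) <= sym_norm u + sym_norm v.
Proof.
rewrite -mkscalarD; apply: sym_norm_le => A cA.
rewrite -(mkscalar_le k) modulusE mkscalarD.
by apply: (le_trans (ler_normD _ _)); apply: lerD; exact: sym_le_norm.
Qed.

Lemma sym_normZ_le (c : K) (u : sym_tensors) : sym_norm (c *: u) <= `|c| * sym_norm u.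
Proof.
rewrite -modulusE -mkscalarM; apply: sym_norm_le => A cA.
rewrite -(mkscalar_le k) mkscalarM !modulusE normrM ler_wpM2l//.
exact: sym_le_norm.
Qed.

Lemma sym_norm_ge0 (u : sym_tensors) : 0 <= sym_norm u.
Proof.
apply: (le_trans (normr_ge0 (u zerof))); apply: sym_le_norm => x.
by rewrite normr0 prodr_ge0.
Qed.

Fact sym_normZ (c : K) (u : sym_tensors) : sym_norm (c *: u) = `|c| * sym_norm u.
Proof.
apply/eqP; rewrite eq_le sym_normZ_le /=.
have [->|c0] := eqVneq c 0; first by rewrite normr0 mul0r sym_norm_ge0.
have /(ler_wpM2l (normr_ge0 c)) := sym_normZ_le c^-1 (c *: u).
by rewrite scalerA mulVf // scale1r mulrA -normrM mulfV // normr1 mul1r.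
Qed.

Lemma contractive_scale (A : form) : exists2 c : K, c != 0 & contractive (scalef c A).
Proof.
have [M HM] := mform_bounded A.
have [M0|M0] := boolP (0 < M).
  exists M^-1; rewrite ?invr_eq0 ?gt_eqF // => x.
  by rewrite normrM normfV (gtr0_norm M0) ler_pdivrMl.
exists 1; first exact: oner_neq0.
move=> x; rewrite normrM normr1 mul1r.
have p0 : 0 <= \prod_i `|x i| by rewrite prodr_ge0.
have [p|p] := eqVneq (\prod_i `|x i|) 0.
  by rewrite (le_trans (HM x)) // p mulr0.
have pp : 0 < \prod_i `|x i| by rewrite lt_def p.
have := le_trans (normr_ge0 _) (HM x).
rewrite pmulr_lge0 // le_eqVlt (negPf M0) orbF => /eqP M00.
by rewrite (le_trans (HM x)) // -M00 mul0r.
Qed.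

Fact sym_norm0_eq0 (u : sym_tensors) : sym_norm u = 0 -> u = 0.
Proof.
move=> u0; apply: val_inj; apply/funext => A /=.
have [c c0 cA] := contractive_scale A.
have := sym_le_norm u cA; rewrite u0 normr_le0 is_tensor_scale; last exact: sym_tensor.
by rewrite mulf_eq0 (negPf c0) => /eqP.
Qed.

HB.instance Definition _ :=
  Lmodule_isNormed.Build K sym_tensors sym_normD sym_normZ sym_norm0_eq0.

Let d := \dim {:X}.
Let b (i : 'I_d) : X := (vbasis {:X})`_i.
Let N := #|{ffun 'I_m -> 'I_d}|.
Let w (j : 'I_N) : form -> K^o := elementary (fun i => b (enum_val j i)).
Let spanned (u : form -> K^o) : Prop :=
  exists c : 'rV[K]_N, u = \sum_j c 0 j *: w j.

Let spannedP (a : K) u v : spanned u -> spanned v -> spanned (a *: u + v).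
Proof.
move=> [c ->] [c' ->]; exists (a *: c + c').
rewrite scaler_sumr -big_split; apply: eq_bigr => j _.
by rewrite !mxE scalerDl scalerA.
Qed.

Let spanned0 : spanned 0.
Proof. by exists 0; rewrite big1 // => j _; rewrite mxE scale0r. Qed.

Let elementary_sum n (x : 'I_m -> X) i (c : 'I_n -> K) (y : 'I_n -> X) :
  elementary (dfwith x i (\sum_t c t *: y t)) =
  \sum_t c t *: elementary (dfwith x i (y t)).
Proof.
apply/funext => A; rewrite fct_sumE /elementary /=.
have A0 : A (dfwith x i 0) = 0.
  have := mform_linear A x i 1 0 0.
  by rewrite scaler0 addr0 mul1r => /esym/eqP; rewrite -subr_eq0 addrK => /eqP.
elim/big_rec2: _ => [//|t r s _ <-].
by rewrite mform_linear.
Qed.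

Let elementary_spanned (x : 'I_m -> X) : spanned (elementary x).
Proof.
suff H (j : nat) : forall y : 'I_m -> X,
    (forall i : 'I_m, (j <= i)%N -> exists t, y i = b t) -> spanned (elementary y).
  by apply: (H m) => i; rewrite leqNgt ltn_ord.
elim: j => [|j IHj] y yb.
  have [g yg] := choice (fun i => yb i (leq0n i)).
  exists (delta_mx 0 (enum_rank [ffun i => g i])).
  rewrite (bigD1 (enum_rank [ffun i => g i])) //= big1 => [|i ij].
    rewrite mxE !eqxx scale1r addr0 /w; congr elementary.
    by apply/funext => i; rewrite enum_rankK ffunE.
  by rewrite mxE (negPf ij) andbF scale0r.
have [jm|mj] := ltnP j m; last first.
  by apply: IHj => i ji; have := leq_trans mj ji; rewrite leqNgt ltn_ord.
pose i0 := Ordinal jm.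
have -> : y = dfwith y i0 (\sum_t coord (vbasis {:X}) t (y i0) *: b t).
  by rewrite -coord_vbasis ?memvf //; apply/funext => i; case: dfwithP.
rewrite elementary_sum; elim/big_ind: _ => [|u1 u2 s1 s2|t _].
- exact: spanned0.
- by rewrite -[u1]scale1r; exact: spannedP.
rewrite -[_ *: _]addr0; apply: spannedP => //; apply: IHj => i ji.
case: dfwithP ji => [_|i' ii' ji]; first by exists t.
by apply: yb; rewrite ltn_neqAle; apply/andP; split.
Qed.

Fact sym_span (u : sym_tensors) :
  exists c : 'rV[K]_N, sym_val u = \sum_j c 0 j *: w j.
Proof.
have [n [c [x ->]]] := sym_tensor u.
elim/big_ind: _ => [|u1 u2 s1 s2|i _]; first exact: spanned0.
  by rewrite -[u1]scale1r; exact: spannedP.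
by rewrite -[_ *: _]addr0; apply: spannedP => //; exact: elementary_spanned.
Qed.

Fact sym_val_linear : linear sym_val.
Proof. by []. Qed.

HB.instance Definition _ := Lmodule_hasFinDim.Build K sym_tensors
  (finite_span_axiom sym_val_linear (@val_inj _ _ sym_tensors) sym_span).

End SymmetricTensors.

Section TensorPowers.
Variables (R : realType) (k : scalar_kind).
Local Notation K := (scalars R k).
Variables (X : finNormedModType K) (m : nat).

Fact power_tensor_subproof (x : X) :
  @elementary R k X m (fun=> x) \in @sym_pred R k X m.
Proof.
apply/asboolP; split => [|s A]; last by [].
by exists 1%N, (fun=> 1), (fun _ _ => x); rewrite big_ord1 scale1r.
Qed.

Definition power_tensor (x : X) : sym_tensors X m := Sym (power_tensor_subproof x).

Definition sym_eval (A : mform X m) (u : sym_tensors X m) : K^o := u A.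

Fact sym_eval_linear A : linear (sym_eval A).
Proof. by []. Qed.

HB.instance Definition _ A :=
  GRing.isLinear.Build K (sym_tensors X m) K^o _ (sym_eval A) (sym_eval_linear A).

Fact sym_eval_continuous (A : mform X m) : continuous (sym_eval A).
Proof.
apply/linear_bounded_continuous/linear_boundedP.
have [c c0 cA] := contractive_scale A.
exists `|c|^-1; split; first by rewrite realV normr_real.
move=> r cr u; apply: (@le_trans _ _ (`|c|^-1 * `|u|)); last first.
  by rewrite ler_wpM2r // ltW.
rewrite ler_pdivlMl ?normr_gt0 // -normrM.
have := sym_le_norm u cA; rewrite is_tensor_scale //; exact: sym_tensor.
Qed.

(* On elementary tensors u = x_1 (x) ... (x) x_m the value u (powf m f) is
   f(x_1) ... f(x_m). *)
Definition power_dual (f : dual_space X) : dual_space (sym_tensors X m) :=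
  Dual (@sym_eval_continuous (powf m f)).

End TensorPowers.

Section ScalarIntegrals.
Variables (R : realType) (k : scalar_kind).
Local Notation K := (scalars R k).
Context d (T : measurableType d) (mu : {measure set T -> \bar R}).

Definition scalar_integrable (h : T -> K) : Prop :=
  mu.-integrable setT (fun a => (scalar_re (h a))%:E) /\
  mu.-integrable setT (fun a => (scalar_im (h a))%:E).

Definition scalar_integral (h : T -> K) : K :=
  mkscalar k (\int[mu]_a scalar_re (h a))%R (\int[mu]_a scalar_im (h a))%R.

End ScalarIntegrals.

Section Frames.
Variables (R : realType) (k : scalar_kind).
Local Notation K := (scalars R k).
Context d (T : measurableType d) (mu : {measure set T -> \bar R}).
Variable V : finNormedModType K.

(* y is the Pettis integral of F. *)
Definition is_weak_integral (F : T -> V) (y : V) : Prop :=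
  forall phi : dual_space V, scalar_integrable mu (fun a => phi (F a) : K) /\
    phi y = scalar_integral mu (fun a => phi (F a) : K).

Definition weak_integral (F : T -> V) : V := get (is_weak_integral F).

Variables (g : T -> dual_space V) (w : T -> V).

Definition frame_operator (x : V) : V := weak_integral (fun a => g a x *: w a).

Definition bessel_family : Prop :=
  (forall (x : V) (phi : dual_space V),
     scalar_integrable mu (fun a => g a x * phi (w a) : K)) /\
  [/\ forall x, exists y, is_weak_integral (fun a => g a x *: w a) y,
      linear frame_operator &
      exists M, forall x, `|frame_operator x| <= M * `|x| ].

Definition asf : Prop := bessel_family /\ bijective frame_operator.

Definition tight_asf : Prop :=
  asf /\ exists2 lambda : K, lambda != 0 & forall x, frame_operator x = lambda *: x.

End Frames.

Section Diagonalizable.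
Variables (K : fieldType) (V : vectType K) (S : V -> V).

Definition is_eigenvector (v : V) (lambda : K) : Prop :=
  v != 0 /\ S v = lambda *: v.

Definition is_eigenvalue (lambda : K) : Prop := exists v, is_eigenvector v lambda.

Definition op_diagonalizable : Prop :=
  exists2 e : seq V, basis_of {:V} e &
    forall v, v \in e -> exists lambda, is_eigenvector v lambda.

End Diagonalizable.

(* Supremum in [0, +oo] of h(a, b) >= 0 over a <> b; it is 0 if there are no
   such a and b. *)
Definition offdiag_sup (R : realType) (T : Type) (h : T -> T -> R) : \bar R :=
  ereal_sup ([set 0%E] `|` [set (h p.1 p.2)%:E | p in ~` diagonal]).

(* Main.v *)
(* Write n = dim Sym^m(X). Evaluating an m-linear form at an m-tuple of basis
   vectors and symmetrising, Sym^m(X) is the space of functions on m-tuples of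
   basis indices that are invariant under permutation, that is, of functions on
   sorted tuples; hence n = C(d + m - 1, m).

   Expanding the tensors tau_b^m in an eigenbasis of S turns
   f_a(tau_b)^m f_b(tau_a)^m into a finite sum of products u(a) v(b) with u and v
   integrable. Fubini is thus only needed for such products, and gives
   int f_a(tau_a)^m = tr S = sum_i l_i and
   int int f_a(tau_b)^m f_b(tau_a)^m = tr S^2 = sum_i l_i^2, where the l_i >= 0 are
   the eigenvalues. The main inequality is Cauchy-Schwarz, with equality if and
   only if all the l_i agree, that is, S is a multiple of the identity. The bounds
   on the suprema follow by splitting the double integral along the diagonal.

   Coordinate functionals have to be continuous to be elements of the dual; this
   is the compactness of the unit sphere of R^n. *)
Require Import Defs.
From HB Require Import structures.
From mathcomp Require Import all_boot all_order all_algebra all_fingroup.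
From mathcomp Require Import all_classical all_reals all_analysis.
From mathcomp Require Import complex measurable_realfun ring.

Set Implicit Arguments.
Unset Strict Implicit.
Unset Printing Implicit Defensive.

Import Order.TTheory GRing.Theory Num.Theory.
Import numFieldNormedType.Exports.

Local Open Scope classical_set_scope.
Local Open Scope ring_scope.

(** * Finite dimensional normed spaces *)

Lemma normr_rV_entry (R : realType) (n : nat) (u : 'rV[R]_n) j : `|u 0 j| <= `|u|.
Proof.
rewrite [leRHS]mx_normrE.
exact: (@le_bigmax _ _ _ _ (fun i : 'I_1 * 'I_n => `|u i.1 i.2|) (0, j)).
Qed.

(** [N] is bounded by a multiple of the sup norm, hence continuous, and attains a minimum on the
    compact unit sphere. The minimum is positive by definiteness, and [C] is its inverse. [N] is a
    bare function so that the real part of a complex norm qualifies too. *)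
Lemma rV_norm_le (R : realType) (n : nat) (N : 'rV[R]_n -> R) :
  (forall u v, N (u + v) <= N u + N v) ->
  (forall a u, N (a *: u) = `|a| * N u) ->
  (forall u, N u = 0 -> u = 0) ->
  exists2 C : R, 0 <= C & forall u, `|u| <= C * N u.
Proof.
move=> ND NZ N0.
have NN u : N (- u) = N u by rewrite -scaleN1r NZ normrN1 mul1r.
have N00 : N 0 = 0 by rewrite -(scale0r 0) NZ normr0 mul0r.
have Nge0 u : 0 <= N u.
  by have := ND u (- u); rewrite NN subrr N00 -mulr2n pmulrn_lge0.
pose B := \sum_i N (delta_mx 0 i).
have NB u : N u <= B * `|u|.
  rewrite {1}(row_sum_delta u) mulr_suml.
  elim/big_ind2: _ => [|a b c e ab ce|i _].
  - by rewrite N00.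
  - by rewrite (le_trans (ND _ _))// lerD.
  by rewrite NZ mulrC ler_wpM2l// normr_rV_entry.
have Ncont : continuous N.
  move=> u; apply/(@cvgrPdist_le _ _ _ (nbhs u) (nbhs_filter u)) => e e0.
  (* [B] itself is 0 when n = 0, so the division is by [B + 1]. *)
  have B1 : 0 < B + 1 by rewrite ltr_wpDl// sumr_ge0.
  have eB : 0 < e / (B + 1) by rewrite divr_gt0.
  have Hu := @cvgr_dist_le _ _ _ (nbhs u) (nbhs_filter u) id u (@cvg_id _ (nbhs u)) _ eB.
  near=> v.
  have H : `|N u - N v| <= N (u - v).
    rewrite ler_norml; apply/andP; split.
      rewrite lerBrDl lerBlDr -[N (u - v)]NN opprB.
      by rewrite (le_trans _ (ND _ _))// [u + _]addrC subrK.
    by rewrite lerBlDl (le_trans _ (ND _ _))// [v + _]addrC subrK.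
  apply: (le_trans H); apply: (le_trans (NB _)).
  apply: (@le_trans _ _ ((B + 1) * `|u - v|)).
    by rewrite ler_wpM2r// lerDl.
  rewrite -ler_pdivlMl// mulrC; near: v.
  exact: Hu.
pose S := [set u : 'rV[R]_n | `|u| = 1].
(* If the sphere is empty, every vector is 0 by normalization, and the constant 0 serves. *)
have [[s Ss]|/forallNP S0] := pselect (S !=set0); last first.
  exists 0 => // u; rewrite mul0r normr_le0; apply/negPn/negP => u0.
  apply: (S0 (`|u|^-1 *: u)); rewrite /S/= normrZ normfV normr_id mulVf//.
  by rewrite normr_eq0.
have cS : compact S.
  apply: bounded_closed_compact.
    exists 1; split; first exact: num_real.
    by move=> x x1 u /= ->; exact: ltW.
  rewrite (_ : S = (fun u => `|u|) @^-1` [set 1])//.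
  apply: closed_comp => [u _|]; first exact: norm_continuous.
  exact: closed_eq.
have [c cS1 cmin] := @compact_EVT_min _ _ N S (ex_intro _ s Ss) cS
  (continuous_subspaceT Ncont).
have c0 : 0 < N c.
  rewrite lt_def Nge0 andbT; apply/negP => /eqP/N0 c0.
  by move: cS1; rewrite inE /S/= c0 normr0 => /esym/eqP; rewrite oner_eq0.
exists (N c)^-1; first by rewrite invr_ge0 ltW.
move=> u; have [->|u0] := eqVneq u 0; first by rewrite normr0 N00 mulr0.
rewrite ler_pdivlMl//.
have un0 : 0 < `|u| by rewrite normr_gt0.
have := cmin (`|u|^-1 *: u); rewrite NZ normfV normr_id ler_pdivlMl// mulrC; apply.
by rewrite inE /S/= normrZ normfV normr_id mulVf// gt_eqF.
Unshelve. all: by end_near.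
Qed.

Section LinearFunctionals.
Variable R : realType.

(** Read through coordinates, the norm of [V] becomes a norm on row vectors, where [rV_norm_le]
    applies. *)
Lemma coord_bounded_real (V : finNormedModType R) (i : 'I_(\dim {:V})) :
  exists2 C, 0 <= C & forall x, `|coord (vbasis {:V}) i x| <= C * `|x|.
Proof.
pose L (u : 'rV[R]_(\dim {:V})) := \sum_j u 0 j *: (vbasis {:V})`_j.
have LD u v : L (u + v) = L u + L v.
  by rewrite -big_split; apply: eq_bigr => j _; rewrite mxE scalerDl.
have LZ a u : L (a *: u) = a *: L u.
  by rewrite scaler_sumr; apply: eq_bigr => j _; rewrite mxE scalerA.
have [|||C C0 HC] := @rV_norm_le R _ (fun u => `|L u|).
- by move=> u v; rewrite LD ler_normD.
- by move=> a u; rewrite LZ normrZ.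
- move=> u /eqP; rewrite normr_eq0 => /eqP u0; apply/rowP => j; rewrite mxE.
  by have /freeP/(_ (fun j => u 0 j) u0 j) := basis_free (vbasisP {:V}).
exists C => // x; have := HC (\row_j coord (vbasis {:V}) j x).
have -> : L (\row_j coord (vbasis {:V}) j x) = x.
  rewrite [RHS](coord_vbasis (memvf x)); apply: eq_bigr => j _.
  by rewrite mxE.
apply: le_trans.
by have := normr_rV_entry (\row_j coord (vbasis {:V}) j x) i; rewrite mxE.
Qed.

Lemma coord_bounded_complex (V : finNormedModType R[i]) (i : 'I_(\dim {:V})) :
  exists2 C, 0 <= C & forall x, `|coord (vbasis {:V}) i x| <= C * `|x|.
Proof.
(* [L] is the parametrization of [V] by the real vector space R^(2n). *)
pose z (u : 'rV[R]_(\dim {:V} + \dim {:V})) j : R[i] :=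
  Complex (u 0 (lshift _ j)) (u 0 (rshift _ j)).
pose L u : V := \sum_j z u j *: (vbasis {:V})`_j.
have LD u v : L (u + v) = L u + L v.
  rewrite -big_split; apply: eq_bigr => j _ /=.
  by rewrite -scalerDl; congr (_ *: _); rewrite /z !mxE.
have LZ (a : R) u : L (a *: u) = a%:C%C *: L u.
  rewrite scaler_sumr; apply: eq_bigr => j _; rewrite /z !mxE scalerA.
  by congr (_ *: _); rewrite /GRing.mul/= !mul0r subr0 addr0.
have nE (x : V) : (complex.Re `|x|)%:C%C = `|x|.
  by apply: RRe_real; exact: normr_real.
have [|||C C0 HC] := @rV_norm_le R _ (fun u => complex.Re `|L u|).
- move=> u v; rewrite -lecR rmorphD !nE LD /= !nE; exact: ler_normD.
- move=> a u; apply: (@complexI R); rewrite rmorphM /= !nE LZ normrZ.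
  by congr (_ * _); rewrite normc_def/= expr0n addr0 sqrtr_sqr.
- move=> u u0; have /eqP : `|L u| = 0 by rewrite -nE u0.
  rewrite normr_eq0 => /eqP {}u0.
  have /freeP/(_ (z u) u0) zu0 := basis_free (vbasisP {:V}).
  apply/rowP => j; rewrite mxE -(splitK j).
  by case: (fintype.split j) => j' /=; have [] := zu0 j'.
(* One [C] bounds the real part of the coordinate, the other its imaginary part. *)
exists (C *+ 2)%:C%C => [|x]; first by rewrite lecR mulrn_wge0.
pose u := row_mx (\row_j complex.Re (coord (vbasis {:V}) j x))
  (\row_j complex.Im (coord (vbasis {:V}) j x)).
have zE j : z u j = coord (vbasis {:V}) j x.
  by rewrite /z row_mxEl row_mxEr !mxE; case: (coord _ _ _).
have Lu : L u = x.
  by rewrite [RHS](coord_vbasis (memvf x)); apply: eq_bigr => j _; rewrite zE.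
rewrite -(nE x) -zE.
have -> : (C *+ 2)%:C%C * (complex.Re `|x|)%:C%C =
    (C * complex.Re `|x| + C * complex.Re `|x|)%:C%C.
  by rewrite -mulr2n -mulrnAl rmorphM.
apply: (@le_trans _ _ (`|u 0 (lshift _ i)| + `|u 0 (rshift _ i)|)%:C%C).
  rewrite [z u i]complexE (le_trans (ler_normD _ _))// rmorphD/=.
  by rewrite normrM (_ : `|'i%C| = 1) ?mul1r ?lerD// normc_def/=
    ?(expr0n, expr1n, addr0, add0r, sqrtr1, sqrtr_sqr).
by rewrite lecR -Lu; apply: lerD; rewrite (le_trans _ (HC u))// normr_rV_entry.
Qed.

Lemma coord_bounded (k : scalar_kind) (V : finNormedModType (scalars R k)) i :
  exists2 C, 0 <= C & forall x, `|coord (vbasis {:V}) i x| <= C * `|x|.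
Proof.
case: k V i => V i; first exact: coord_bounded_real.
exact: coord_bounded_complex.
Qed.

(** A functional is a finite combination of the bounded coordinates. This makes the coordinate
    functionals of any basis elements of [dual_space]. *)
Lemma finite_dim_linear_continuous (k : scalar_kind)
    (V : finNormedModType (scalars R k)) (phi : {linear V -> (scalars R k)^o}) :
  continuous phi.
Proof.
apply/linear_bounded_continuous/linear_boundedP.
have [C C0 HC] : exists2 C : 'I_(\dim {:V}) -> scalars R k, (forall i, 0 <= C i) &
    forall i x, `|coord (vbasis {:V}) i x| <= C i * `|x|.
  have /choice[C HC] : forall i, exists C, 0 <= C /\
      forall x, `|coord (vbasis {:V}) i x| <= C * `|x|.
    by move=> i; have [C] := coord_bounded i; exists C.
  by exists C => i; case: (HC i).
pose B := \sum_i C i * `|phi (vbasis {:V})`_i|.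
have B0 : 0 <= B by rewrite sumr_ge0// => i _; rewrite mulr_ge0.
exists B; split; first exact: ger0_real.
move=> r Br x; apply: (@le_trans _ _ (B * `|x|)); last by rewrite ler_wpM2r// ltW.
rewrite {1}(coord_vbasis (memvf x)) linear_sum (le_trans (ler_norm_sum _ _ _))//.
rewrite mulr_suml ler_sum// => i _; rewrite linearZ normrM mulrAC ler_wpM2r//.
Qed.

End LinearFunctionals.

(** * The dimension of the symmetric tensor power *)

Lemma dimv_bij (K : fieldType) (U V : vectType K) (h : U -> V) :
  linear h -> injective h -> (forall v, exists u, h u = v) ->
  \dim {:U} = \dim {:V}.
Proof.
move=> hlin hinj hsurj.
pose hL := HB.pack_for {linear U -> V} h (GRing.isLinear.Build _ _ _ _ h hlin).
have kerh : lker (linfun hL) == 0%VS.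
  by apply/lker0P => u v; rewrite !lfunE; exact: hinj.
rewrite -(limg_dim_eq (f := linfun hL)); last by rewrite (eqP kerh) capv0.
congr (\dim _); apply/vspaceP => v; rewrite memvf.
have [u <-] := hsurj v.
by rewrite -[h u](lfunE hL) memv_img// memvf.
Qed.

Lemma card_sorted_tuples_ord (d m : nat) :
  #|{: {t : m.-tuple 'I_d | sorted leq (map val t)}}| = 'C(d + m - 1, m).
Proof.
rewrite card_sig; case: d => [|d].
  (* For d = 0 the only tuple is the empty one. With truncated subtraction the binomial is 'C(m - 1,
     m), which is 1 for m = 0 and 0 otherwise. *)
  case: m => [|m]; last by rewrite add0n subn1 bin_small// fintype.eq_card0// => -[[|[]]].
  by rewrite (@fintype.eq_card1 _ ([tuple] : 0.-tuple _)) ?bin0// => t; rewrite !inE [t]tuple0 eqxx.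
rewrite addSn subn1 addnC -card_sorted_tuples -sum1dep_card -sum1_card.
by apply: eq_bigl => t; rewrite !inE.
Qed.

Section SymDimension.
Variables (R : realType) (k : scalar_kind).
Local Notation K := (scalars R k).
Variables (X : finNormedModType K) (m : nat).

Fact prodf_linear (phi : 'I_m -> dual_space X) (x : 'I_m -> X) i a (u v : X) :
  \prod_j phi j (dfwith x i (a *: u + v) j) =
  a * \prod_j phi j (dfwith x i u j) + \prod_j phi j (dfwith x i v j) :> K.
Proof.
have E w : \prod_j phi j (dfwith x i w j) =
    phi i w * \prod_(j | j != i) phi j (x j) :> K.
  rewrite (bigD1 i) //= dfwithin; congr (_ * _); apply: eq_bigr => j ji.
  by rewrite dfwithout // eq_sym.
by rewrite !E linearP mulrDl mulrA.
Qed.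

Fact prodf_bounded (phi : 'I_m -> dual_space X) :
  exists M, forall x : 'I_m -> X, `|\prod_i phi i (x i) : K| <= M * \prod_i `|x i|.
Proof.
have /choice[M HM] i : exists M, forall x, `|phi i x : K| <= M * `|x|.
  by have [M _ HM] := dual_bound (phi i); exists M.
exists (\prod_(i < m) M i) => x.
rewrite -big_split normr_prod; apply: ler_prod => i _.
by rewrite normr_ge0 HM.
Qed.

(** Unlike in [powf], the factors may differ; with coordinate functionals these forms are dual to
    the elementary tensors of basis vectors. *)
Definition prodf (phi : 'I_m -> dual_space X) : mform X m :=
  MForm (prodf_linear phi) (prodf_bounded phi).

Lemma permf_prodf (phi : 'I_m -> dual_space X) (s : 'S_m) :
  permf (prodf phi) s = prodf (phi \o (s^-1)%g).
Proof.
apply: mform_eq => x /=; rewrite [RHS](reindex_inj (@perm_inj _ s)) /=.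
by apply: eq_bigr => j _; rewrite permK.
Qed.

Local Notation d := (\dim {:X}).
Local Notation e := (vbasis {:X}).

Definition basis_dual (i : 'I_d) : dual_space X :=
  Dual (@finite_dim_linear_continuous R k X (coord e i)).

Definition coord_form (g : 'I_m -> 'I_d) : mform X m := prodf (basis_dual \o g).

Definition basis_tensor (g : 'I_m -> 'I_d) : mform X m -> K^o :=
  elementary (fun i => e`_(g i)).

Lemma coord_form_basis_tensor (g h : {ffun 'I_m -> 'I_d}) :
  basis_tensor g (coord_form h) = (g == h)%:R.
Proof.
rewrite /basis_tensor /elementary /=.
under eq_bigr do rewrite coord_free ?(basis_free (vbasisP _))//.
have [->|gh] := eqVneq g h; first by rewrite big1// => i _; rewrite eqxx.
have [i gi] : exists i, g i != h i.
  apply/existsP; rewrite -negb_forall; apply: contra gh => /forallP gh.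
  by apply/eqP/ffunP => i; apply/eqP.
by rewrite (bigD1 i)//= (negPf gi) mul0r.
Qed.

Lemma coord_form_sum (c : {ffun 'I_m -> 'I_d} -> K) (h : {ffun 'I_m -> 'I_d}) :
  (\sum_g c g *: basis_tensor g) (coord_form h) = c h.
Proof.
rewrite fct_sumE (bigD1 h)// big1 => [|g gh].
  rewrite -[(_ *: _) _]/(c h * basis_tensor h (coord_form h)).
  by rewrite coord_form_basis_tensor eqxx mulr1 [LHS]addr0.
rewrite -[(_ *: _) _]/(c g * basis_tensor g (coord_form h)).
by rewrite coord_form_basis_tensor (negPf gh) mulr0.
Qed.

(** Some coefficients exist by [sym_span]; evaluation at the dual forms [coord_form g] identifies
    them. *)
Lemma sym_tensor_expand (u : sym_tensors X m) :
  sym_val u =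
  \sum_(g : {ffun 'I_m -> 'I_d}) u (coord_form g) *: basis_tensor g.
Proof.
have [c uc] := sym_span u.
have {}uc : sym_val u =
    \sum_(g : {ffun 'I_m -> 'I_d}) c 0 (enum_rank g) *: basis_tensor g.
  rewrite uc (reindex enum_rank)/=; last first.
    by apply: onW_bij; exact: enum_rank_bij.
  by apply: eq_bigr => g _; rewrite enum_rankK.
rewrite [LHS]uc; apply: eq_bigr => g _; congr (_ *: _).
by rewrite uc coord_form_sum.
Qed.

Let leI := relpre (val : 'I_d -> nat) leq.

Let leI_total : total leI.
Proof. by move=> i j; exact: leq_total. Qed.

Let leI_trans : transitive leI.
Proof. by move=> i j h; exact: leq_trans. Qed.

Let leI_anti : antisymmetric leI.
Proof. by move=> i j /anti_leq/val_inj. Qed.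

Local Notation T := {t : m.-tuple 'I_d | sorted leq (map val t)}.

Fact sort_index_subproof (g : 'I_m -> 'I_d) :
  sorted leq (map val (sort_tuple leI [tuple g i | i < m])).
Proof. by rewrite sorted_map sort_sorted. Qed.

(** Encodes the orbit of [g] under permutations of its arguments by the sorted member of that
    orbit. *)
Definition sort_index (g : 'I_m -> 'I_d) : T :=
  exist _ (sort_tuple leI [tuple g i | i < m]) (sort_index_subproof g).

Lemma sort_index_perm (g : 'I_m -> 'I_d) (s : 'S_m) :
  sort_index (g \o s) = sort_index g.
Proof.
apply/val_inj/val_inj => /=; apply/(perm_sortP leI_total leI_trans leI_anti).
apply/(@tuple_permP _ m _ [tuple g i | i < m]); exists s => /=.
by apply: eq_map => i; rewrite tnth_mktuple.
Qed.

Lemma sort_index_sorted (t : T) : sort_index (tnth (val t)) = t.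
Proof.
apply/val_inj/val_inj => /=; rewrite map_tnth_enum sorted_sort//.
by rewrite -sorted_map; exact: valP t.
Qed.

Lemma sort_indexE (g : 'I_m -> 'I_d) :
  exists s : 'S_m, tnth (val (sort_index g)) =1 g \o s.
Proof.
have /tuple_permP[s sE] : perm_eq (sort leI [tuple g i | i < m]) [tuple g i | i < m].
  by rewrite perm_sort.
exists s => i /=; have := congr1 (fun r => nth (g i) r i) sE.
by rewrite -!tnth_nth tnth_mktuple => ->; rewrite tnth_mktuple.
Qed.

(** The coefficients of a symmetric tensor are constant on orbits of index maps, so reading them at
    sorted tuples is a linear bijection onto row vectors. *)
Lemma dim_sym_tensors : \dim {: sym_tensors X m} = 'C(d + m - 1, m).
Proof.
rewrite -card_sorted_tuples_ord.
pose h (u : sym_tensors X m) : 'rV[K]_#|{: T}| :=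
  \row_i u (coord_form (tnth (val (enum_val i)))).
rewrite (@dimv_bij _ _ _ h); first by rewrite [LHS]dimvf dim_matrix mul1r.
- by move=> a u v; apply/rowP => i; rewrite !mxE.
- suff H u : h u = 0 -> u = 0.
    move=> u v huv; apply/eqP; rewrite -subr_eq0; apply/eqP/H/rowP => i.
    rewrite !mxE; set A := coord_form _; apply/eqP.
    rewrite -[(u - v) A]/(u A - v A) subr_eq0; apply/eqP.
    by have /rowP/(_ i) := huv; rewrite !mxE.
  (* Each coefficient equals, by symmetry, the one at the sorted index, which is an entry of
     [h u]. *)
  move=> hu; apply/val_inj; rewrite [LHS]sym_tensor_expand big1// => g _.
  have [s sE] := sort_indexE g.
  have /rowP/(_ (enum_rank (sort_index g))) := hu.
  rewrite !mxE enum_rankK (_ : coord_form _ = permf (coord_form g) (s^-1)%g).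
    by case/asboolP: (sym_valP u) => _ -> ->; rewrite scale0r.
  rewrite permf_prodf invgK; apply: mform_eq => x /=.
  by apply: eq_bigr => i _; rewrite sE.
move=> r.
(* The preimage of [r]: spread each entry of [r] over the whole orbit of its sorted tuple. *)
pose w : mform X m -> K^o := \sum_(g : {ffun 'I_m -> 'I_d})
  r 0 (enum_rank (sort_index g)) *: basis_tensor g.
have wP : w \in @sym_pred R k X m.
  apply/asboolP; split.
    pose G := {ffun 'I_m -> 'I_d}; exists #|{: G}|.
    exists (fun i => r 0 (enum_rank (sort_index (enum_val i : G)))).
    exists (fun i j => e`_((enum_val i : G) j)).
    rewrite [RHS](reindex enum_rank)/=; last first.
      by apply: onW_bij; exact: enum_rank_bij.
    by apply: eq_bigr => g _; rewrite enum_rankK.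
  move=> s A; rewrite /w !fct_sumE.
  (* Permuting the arguments of [A] replaces [g] by [g \o s], a bijection of index maps that
     preserves orbits. *)
  rewrite [RHS](reindex (fun g : {ffun 'I_m -> 'I_d} => [ffun i => g (s i)]))/=.
    apply: eq_bigr => g _; congr (_ * A _).
      congr (r 0 (enum_rank _)); rewrite -(sort_index_perm g s).
      by congr sort_index; apply/funext => i; rewrite ffunE.
    by apply/funext => i /=; rewrite ffunE.
  apply: onW_bij; exists (fun g : {ffun 'I_m -> 'I_d} => [ffun i => g ((s^-1)%g i)]) => g.
    by apply/ffunP => i; rewrite !ffunE permKV.
  by apply/ffunP => i; rewrite !ffunE permK.
exists (Defs.Sym wP); apply/rowP => i; rewrite mxE.
set t := enum_val i; pose g0 : {ffun 'I_m -> 'I_d} := [ffun j => tnth (val t) j].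
have g0E : tnth (val t) = g0 by apply/funext => j; rewrite ffunE.
rewrite g0E; pose c (g : {ffun 'I_m -> 'I_d}) := r 0 (enum_rank (sort_index g)).
transitivity (c g0); first exact: (coord_form_sum c g0).
by rewrite /c -g0E sort_index_sorted enum_valK.
Qed.

End SymDimension.

(** * Scalar integrals *)

Section ScalarParts.
Variables (R : realType) (k : scalar_kind).
Local Notation K := (scalars R k).

Lemma scalar_reD (a b : K) : scalar_re (a + b) = scalar_re a + scalar_re b.
Proof. by case: k a b => //= -[? ?] [? ?]. Qed.

Lemma scalar_imD (a b : K) : scalar_im (a + b) = scalar_im a + scalar_im b.
Proof. by case: k a b => [? ?|[? ?] [? ?]] //=; rewrite addr0. Qed.

(** One formula covers both fields, because [scalar_im] vanishes identically over the reals. *)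
Lemma scalar_reM (a b : K) :
  scalar_re (a * b) = scalar_re a * scalar_re b - scalar_im a * scalar_im b.
Proof. by case: k a b => [? ?|[? ?] [? ?]] //=; rewrite mulr0 subr0. Qed.

Lemma scalar_imM (a b : K) :
  scalar_im (a * b) = scalar_re a * scalar_im b + scalar_im a * scalar_re b.
Proof. by case: k a b => [? ?|[? ?] [? ?]] //=; rewrite mulr0 mul0r addr0. Qed.

Lemma scalar_re_le (a b : K) : a <= b -> scalar_re a <= scalar_re b.
Proof. by case: k a b => [//|[? ?] [? ?]] /=; rewrite lecE => /andP[]. Qed.

Lemma scalar_re_modulus_le (a : K) : `|scalar_re a| <= modulus a.
Proof.
case: k a => [//|a] /=; rewrite /modulus/= -lecR.
have -> : (complex.Re `|a|)%:C%C = `|a| by apply: RRe_real; exact: normr_real.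
exact: normc_ge_Re.
Qed.

(** Exhibits the modulus as a continuous function of the two real parts, from which its
    measurability follows. *)
Lemma modulus_sqrt (a : K) :
  modulus a = Num.sqrt (scalar_re a ^+ 2 + scalar_im a ^+ 2).
Proof.
case: k a => [a|[a b]] /=; last first.
  by rewrite -[LHS]/(complex.Re `|Complex a b : R[i]|) normc_def.
by rewrite expr0n addr0 sqrtr_sqr.
Qed.

Lemma modulusM (a b : K) : modulus (a * b) = modulus a * modulus b.
Proof.
apply/eqP; rewrite eq_le -!(mkscalar_le k) mkscalarM !modulusE normrM.
by rewrite lexx.
Qed.

Lemma modulusX (a : K) n : modulus (a ^+ n) = modulus a ^+ n.
Proof.
elim: n => [|n IHn]; last by rewrite !exprS modulusM IHn.
by rewrite !expr0 /modulus normr1; case: k.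
Qed.

Lemma mkscalar_add (a b a' b' : R) :
  mkscalar k (a + a') (b + b') = mkscalar k a b + mkscalar k a' b'.
Proof. by rewrite /mkscalar; case: k. Qed.

Lemma mkscalar_mull (c : K) (a b : R) :
  mkscalar k (scalar_re c * a - scalar_im c * b) (scalar_re c * b + scalar_im c * a) =
  c * mkscalar k a b.
Proof. by rewrite /mkscalar; case: k c => [c|[? ?]] //=; rewrite mul0r subr0. Qed.

Lemma scalar_re_mkscalar (a b : R) : scalar_re (mkscalar k a b) = a.
Proof. by rewrite /mkscalar; case: k. Qed.

End ScalarParts.

Section ScalarIntegralTheory.
Variables (R : realType) (k : scalar_kind).
Local Notation K := (scalars R k).
Context d (T : measurableType d) (mu : {measure set T -> \bar R}).
Implicit Types (h g : T -> K) (c : K).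

Local Notation rint f := (mu.-integrable setT (EFin \o f)).

Let rintD (f1 f2 : T -> R) : rint f1 -> rint f2 -> rint (fun x => f1 x + f2 x).
Proof. by move=> i1 i2; exact: (integrableD measurableT i1 i2). Qed.

Let rintZ (a : R) (f1 : T -> R) : rint f1 -> rint (fun x => a * f1 x).
Proof. by move=> i1; exact: (integrableZl measurableT a i1). Qed.

Let rintB (f1 f2 : T -> R) : rint f1 -> rint f2 -> rint (fun x => f1 x - f2 x).
Proof. by move=> i1 i2; exact: (integrableB measurableT i1 i2). Qed.

Lemma scalar_integrableD h g : scalar_integrable mu h -> scalar_integrable mu g ->
  scalar_integrable mu (fun a => h a + g a).
Proof.
move=> [h1 h2] [g1 g2]; split.
  by under eq_fun do rewrite scalar_reD; exact: rintD.
by under eq_fun do rewrite scalar_imD; exact: rintD.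
Qed.

Lemma scalar_integralD h g : scalar_integrable mu h -> scalar_integrable mu g ->
  scalar_integral mu (fun a => h a + g a) =
  scalar_integral mu h + scalar_integral mu g.
Proof.
move=> [h1 h2] [g1 g2]; rewrite /scalar_integral.
under eq_Rintegral do rewrite scalar_reD.
under [X in mkscalar _ _ X]eq_Rintegral do rewrite scalar_imD.
by rewrite !RintegralD// mkscalar_add.
Qed.

Lemma scalar_integrableZ c h : scalar_integrable mu h ->
  scalar_integrable mu (fun a => c * h a).
Proof.
move=> [h1 h2]; split.
  by under eq_fun do rewrite scalar_reM; apply: rintB; exact: rintZ.
by under eq_fun do rewrite scalar_imM; apply: rintD; exact: rintZ.
Qed.

Lemma scalar_integralZ c h : scalar_integrable mu h ->
  scalar_integral mu (fun a => c * h a) = c * scalar_integral mu h.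
Proof.
move=> [h1 h2]; rewrite /scalar_integral.
under eq_Rintegral do rewrite scalar_reM.
under [X in mkscalar _ _ X]eq_Rintegral do rewrite scalar_imM.
rewrite RintegralB ?RintegralD ?RintegralZl//; try exact: rintZ.
exact: mkscalar_mull.
Qed.

Lemma scalar_re_integral h :
  scalar_re (scalar_integral mu h) = (\int[mu]_a scalar_re (h a))%R.
Proof. exact: scalar_re_mkscalar. Qed.

Lemma scalar_im_integral h :
  scalar_im (scalar_integral mu h) = (\int[mu]_a scalar_im (h a))%R.
Proof.
by rewrite /scalar_integral; case: k h => //= h; rewrite /Rintegral integral0.
Qed.

Lemma scalar_integral0 : scalar_integral mu (fun=> 0 : K) = 0.
Proof.
rewrite /scalar_integral [X in mkscalar _ X _](_ : _ = 0).
  rewrite [X in mkscalar _ _ X](_ : _ = 0) ?mkscalar0//.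
  by rewrite /Rintegral integral0_eq// => x _; case: k.
by rewrite /Rintegral integral0_eq// => x _; case: k.
Qed.

Lemma scalar_integrable0 : scalar_integrable mu (fun=> 0 : K).
Proof.
by split; apply: eq_integrable (integrable0 _ _) => // x _; case: k.
Qed.

Lemma scalar_integrable_sum (I : Type) (s : seq I) (F : I -> T -> K) :
  (forall i, scalar_integrable mu (F i)) ->
  scalar_integrable mu (fun a => \sum_(i <- s) F i a).
Proof.
move=> iF; elim: s => [|i s IHs].
  by under eq_fun do rewrite big_nil; exact: scalar_integrable0.
by under eq_fun do rewrite big_cons; exact: scalar_integrableD.
Qed.

Lemma scalar_integral_sum (I : Type) (s : seq I) (F : I -> T -> K) :
  (forall i, scalar_integrable mu (F i)) ->
  scalar_integral mu (fun a => \sum_(i <- s) F i a) =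
  \sum_(i <- s) scalar_integral mu (F i).
Proof.
move=> iF; elim: s => [|i s IHs].
  by under eq_fun do rewrite big_nil; rewrite scalar_integral0 big_nil.
under eq_fun do rewrite big_cons.
rewrite scalar_integralD// ?big_cons ?IHs//; exact: scalar_integrable_sum.
Qed.

Lemma measurable_modulus h : scalar_integrable mu h ->
  measurable_fun setT (fun a => modulus (h a)).
Proof.
move=> [/measurable_int/measurable_EFinP h1 /measurable_int/measurable_EFinP h2].
under eq_fun do rewrite modulus_sqrt.
apply: (measurableT_comp (f := @Num.sqrt R)).
  apply: continuous_measurable_fun; exact: sqrt_continuous.
by apply: measurable_funD; exact: measurable_funX.
Qed.

(** The right side stays in [\bar R], so only measurability of the modulus has to be checked. The
    triangle inequality is applied to the real part alone. *)
Lemma scalar_re_integral_le h : scalar_integrable mu h ->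
  ((scalar_re (scalar_integral mu h))%:E <= \int[mu]_a (modulus (h a))%:E)%E.
Proof.
move=> ih; have [h1 _] := ih.
rewrite scalar_re_integral /Rintegral fineK; last exact: integrable_fin_num.
apply: (le_trans (lee_abs _)).
apply: (le_trans (le_abse_integral _ measurableT (measurable_int _ h1))).
apply: ge0_le_integral => //.
- exact: measurableT_comp (measurable_int _ h1).
- exact/measurable_EFinP/measurable_modulus.
- by move=> a _; rewrite lee_fin scalar_re_modulus_le.
Qed.

End ScalarIntegralTheory.

(** * Fubini's theorem for products of functions of separate variables *)

Section ScalarFubini.
Variables (R : realType) (k : scalar_kind).
Local Notation K := (scalars R k).
Context d (T : measurableType d) (mu : {sigma_finite_measure set T -> \bar R}).

Local Notation rint m f := (m.-integrable setT (EFin \o f)).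

(** By Tonelli the integral of |f(x) g(y)| is the product of two finite integrals. *)
Lemma integrable_tensor (f g : T -> R) : rint mu f -> rint mu g ->
  rint (mu \x mu)%E (fun p => f p.1 * g p.2).
Proof.
move=> i_f i_g; have [/measurable_EFinP mf _] := integrableP _ _ _ i_f.
have [/measurable_EFinP mg _] := integrableP _ _ _ i_g.
have mfg : measurable_fun setT (fun p : T * T => f p.1 * g p.2).
  by apply: measurable_funM; apply: measurableT_comp.
apply/integrable12ltyP; first exact/measurable_EFinP.
have E x : (\int[mu]_y `|(f x * g y)%:E| = `|f x|%:E * \int[mu]_y `|(g y)%:E|)%E.
  rewrite -ge0_integralZl//; last exact/measurable_EFinP/measurableT_comp.
  by apply: eq_integral => y _; rewrite /= normrM.
under eq_integral do rewrite E.
have [_ fl] := integrableP _ _ _ i_f; have [_ gl] := integrableP _ _ _ i_g.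
rewrite ge0_integralZr//.
- by rewrite lte_mul_pinfty// ?integral_ge0// ge0_fin_numE// integral_ge0.
- exact/measurable_EFinP/measurableT_comp.
- exact: integral_ge0.
Qed.

Lemma Rintegral_tensor (f g : T -> R) : rint mu f -> rint mu g ->
  (\int[(mu \x mu)%E]_p (f p.1 * g p.2) =
   (\int[mu]_x f x) * (\int[mu]_x g x))%R.
Proof.
move=> i_f i_g; rewrite /Rintegral -fineM; [|exact: integrable_fin_num..].
congr fine; rewrite -(integral12_prod_meas1 (integrable_tensor i_f i_g)).
rewrite /fubini_F.
have gfin : (\int[mu]_y (g y)%:E \is a fin_num)%E.
  exact: (integrable_fin_num measurableT i_g).
have E x : (\int[mu]_y (f x * g y)%:E = (f x)%:E * \int[mu]_y (g y)%:E)%E.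
  by rewrite -integralZl.
rewrite (eq_integral _ _ (fun x _ => E x)).
by rewrite -(fineK gfin) integralZr.
Qed.

Lemma scalar_integrable_tensor (f g : T -> K) :
  scalar_integrable mu f -> scalar_integrable mu g ->
  scalar_integrable (mu \x mu)%E (fun p => f p.1 * g p.2).
Proof.
move=> [f1 f2] [g1 g2]; split.
  under eq_fun do rewrite scalar_reM.
  exact: (integrableB measurableT (integrable_tensor f1 g1) (integrable_tensor f2 g2)).
under eq_fun do rewrite scalar_imM.
exact: (integrableD measurableT (integrable_tensor f1 g2) (integrable_tensor f2 g1)).
Qed.

Lemma scalar_integral_tensor (f g : T -> K) :
  scalar_integrable mu f -> scalar_integrable mu g ->
  scalar_integral (mu \x mu)%E (fun p => f p.1 * g p.2) =
  scalar_integral mu f * scalar_integral mu g.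
Proof.
move=> [f1 f2] [g1 g2]; rewrite /scalar_integral.
under eq_Rintegral do rewrite scalar_reM.
under [X in mkscalar _ _ X]eq_Rintegral do rewrite scalar_imM.
rewrite -[RHS]mkscalar_mull -/(scalar_integral mu f).
rewrite scalar_re_integral scalar_im_integral.
rewrite RintegralB//; [|exact: (integrable_tensor f1 g1)|exact: (integrable_tensor f2 g2)].
rewrite RintegralD//; [|exact: (integrable_tensor f1 g2)|exact: (integrable_tensor f2 g1)].
rewrite (Rintegral_tensor f1 g1) (Rintegral_tensor f1 g2).
by rewrite (Rintegral_tensor f2 g1) (Rintegral_tensor f2 g2).
Qed.

End ScalarFubini.

(** * Frame operators in an eigenbasis *)

(** Expresses the defect in the Cauchy-Schwarz inequality as a sum of squares, so that the
    inequality and its equality case both come from one identity. *)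
Lemma sum_sqr_diff (F : comNzRingType) (n : nat) (l : 'I_n -> F) :
  \sum_i \sum_j (l i - l j) ^+ 2 =
  (n%:R * (\sum_i l i ^+ 2) - (\sum_i l i) ^+ 2) *+ 2.
Proof.
have E i : \sum_j (l i - l j) ^+ 2 =
    n%:R * l i ^+ 2 - l i * (\sum_j l j) *+ 2 + \sum_j l j ^+ 2.
  under eq_bigr do rewrite sqrrB.
  rewrite big_split sumrB /= sumr_const card_ord mulr_natl; congr (_ - _ + _).
  by rewrite mulr_sumr sumrMnl.
under eq_bigr do rewrite E.
rewrite big_split sumrB /= sumr_const card_ord -mulr_sumr sumrMnl -mulr_suml.
by rewrite -[X in _ + X = _]mulr_natl; ring.
Qed.

Section CauchySchwarz.
Variables (K : numFieldType) (n : nat) (l : 'I_n -> K).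
Hypothesis l_ge0 : forall i, 0 <= l i.

(** In a possibly complex field only squares of real elements are nonnegative; nonnegativity of the
    [l i] makes the differences real. *)
Let sqr_diff_ge0 i j : 0 <= (l i - l j) ^+ 2.
Proof. by rewrite real_exprn_even_ge0// rpredB// ger0_real. Qed.

Lemma sqr_sum_le : n%:R^-1 * (\sum_i l i) ^+ 2 <= \sum_i l i ^+ 2.
Proof.
have [n0|n0] := eqVneq n 0%N.
  (* For n = 0 the left side is 0, since the inverse of 0 is 0. *)
  by rewrite [X in X%:R]n0 invr0 mul0r sumr_ge0// => i _; rewrite exprn_ge0.
rewrite ler_pdivrMl ?ltr0n ?lt0n// -subr_ge0 -(pmulrn_lge0 _ (ltn0Sn 1)).
by rewrite -sum_sqr_diff sumr_ge0// => i _; rewrite sumr_ge0.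
Qed.

(** Equality makes the double sum of squared differences 0, and each of its terms is nonnegative. *)
Lemma sqr_sum_eq : \sum_i l i ^+ 2 = n%:R^-1 * (\sum_i l i) ^+ 2 ->
  forall i j, l i = l j.
Proof.
move=> eq_l i j; have n0 : n%:R != 0 :> K.
  by rewrite pnatr_eq0 -lt0n (leq_ltn_trans _ (ltn_ord i)).
have : \sum_i \sum_j (l i - l j) ^+ 2 = 0.
  by rewrite sum_sqr_diff eq_l mulVKf// subrr mul0rn.
move=> /eqP; rewrite psumr_eq0; last by move=> *; rewrite sumr_ge0.
move=> /allP/(_ i (mem_index_enum i)) /=.
rewrite psumr_eq0// => /allP/(_ j (mem_index_enum j)) /=.
by rewrite sqrf_eq0 subr_eq0 => /eqP.
Qed.

End CauchySchwarz.

(** * The trace of a frame operator and of its square *)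

Section BesselTrace.
Variables (R : realType) (k : scalar_kind).
Local Notation K := (scalars R k).
Context disp (T : measurableType disp) (mu : {sigma_finite_measure set T -> \bar R}).
Variable V : finNormedModType K.
Variables (g : T -> dual_space V) (w : T -> V).
Hypothesis gw : bessel_family mu g w.
Local Notation S := (frame_operator mu g w).

Lemma frame_operatorE (phi : dual_space V) (x : V) :
  phi (S x) = scalar_integral mu (fun a => g a x * phi (w a) : K).
Proof.
have [_ [/(_ x)/getPex/(_ phi)[_ ->] _ _]] := gw.
by congr scalar_integral; apply/funext => a; rewrite linearZ.
Qed.

Variables (n : nat) (e : n.-tuple V).
Hypothesis e_basis : basis_of {:V} e.

Let cdual (i : 'I_n) : dual_space V :=
  Dual (@finite_dim_linear_continuous R k V (coord e i)).

(** Matrix entries of the rank one operator sending x to [g a x *: w a]; integrating them gives the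
    entries of the matrix of [S]. *)
Let G (i j : 'I_n) a : K := g a e`_i * cdual j (w a).

Let integrableG i j : scalar_integrable mu (G i j).
Proof. by case: gw => /(_ e`_i (cdual j)). Qed.

Let integralG i j : scalar_integral mu (G i j) = coord e j (S e`_i).
Proof. by rewrite -(frame_operatorE (cdual j)). Qed.

Let gwE a b : g a (w b) = \sum_i cdual i (w b) * g a e`_i :> K.
Proof.
rewrite [X in g a X](coord_basis e_basis (memvf (w b))) linear_sum.
by apply: eq_bigr => i _; rewrite linearZ.
Qed.

Let trace_expand a : g a (w a) = \sum_i G i i a :> K.
Proof. by rewrite gwE; apply: eq_bigr => i _; rewrite mulrC. Qed.

(** Expanding both [w a] and [w b] in the basis separates the variables: the left side is the trace
    of the product of the rank one matrices at [a] and [b]. *)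
Let energy_expand a b : g a (w b) * g b (w a) =
  \sum_(p : 'I_n * 'I_n) G p.1 p.2 a * G p.2 p.1 b :> K.
Proof.
rewrite !gwE big_distrlr pair_bigA /=; apply: eq_bigr => -[i j] _ /=.
rewrite /G [X in X * _ = _]mulrC -!mulrA; congr (_ * _).
by rewrite mulrC -mulrA.
Qed.

Lemma trace_integrable : scalar_integrable mu (fun a => g a (w a) : K).
Proof.
by under eq_fun do rewrite trace_expand; apply: scalar_integrable_sum => i.
Qed.

Lemma trace_integral :
  scalar_integral mu (fun a => g a (w a) : K) = \sum_i coord e i (S e`_i).
Proof.
under eq_fun do rewrite trace_expand.
by rewrite scalar_integral_sum//; apply: eq_bigr => i _; rewrite integralG.
Qed.

Lemma energy_integrable :
  scalar_integrable (mu \x mu)%E (fun p => g p.1 (w p.2) * g p.2 (w p.1) : K).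
Proof.
under eq_fun do rewrite energy_expand.
apply: scalar_integrable_sum => -[i j] /=; exact: scalar_integrable_tensor.
Qed.

Lemma energy_integral :
  scalar_integral (mu \x mu)%E (fun p => g p.1 (w p.2) * g p.2 (w p.1) : K) =
  \sum_(p : 'I_n * 'I_n) coord e p.2 (S e`_p.1) * coord e p.1 (S e`_p.2).
Proof.
under eq_fun do rewrite energy_expand.
rewrite scalar_integral_sum; last first.
  by move=> -[i j] /=; exact: scalar_integrable_tensor.
by apply: eq_bigr => -[i j] _ /=; rewrite scalar_integral_tensor// !integralG.
Qed.

(** For fixed b the inner integral is a finite combination of the functions [G p.2 p.1], so both
    integrations are done term by term, without passing through the product measure. *)
Lemma energy_iterated :
  scalar_integral mu (fun b => scalar_integral mu (fun a => g a (w b) * g b (w a))) =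
  \sum_(p : 'I_n * 'I_n) coord e p.2 (S e`_p.1) * coord e p.1 (S e`_p.2) :> K.
Proof.
have E b : scalar_integral mu (fun a => g a (w b) * g b (w a) : K) =
    \sum_(p : 'I_n * 'I_n) coord e p.2 (S e`_p.1) * G p.2 p.1 b.
  under eq_fun do rewrite energy_expand.
  under eq_fun do under eq_bigr do rewrite mulrC.
  rewrite scalar_integral_sum => [|p]; last exact: scalar_integrableZ.
  by apply: eq_bigr => p _; rewrite scalar_integralZ// integralG mulrC.
under eq_fun do rewrite E.
rewrite scalar_integral_sum => [|p]; last exact: scalar_integrableZ.
by apply: eq_bigr => p _; rewrite scalar_integralZ// integralG.
Qed.

End BesselTrace.

(** * Diagonalizable frame operators and the equality case *)

Section DiagonalizableFrame.
Variables (R : realType) (k : scalar_kind).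
Local Notation K := (scalars R k).
Context disp (T : measurableType disp) (mu : {sigma_finite_measure set T -> \bar R}).
Variable V : finNormedModType K.
Variables (g : T -> dual_space V) (w : T -> V).
Hypothesis gw : bessel_family mu g w.
Local Notation S := (frame_operator mu g w).
Hypothesis S_diag : op_diagonalizable S.
Hypothesis S_ge0 : forall lambda, is_eigenvalue S lambda -> 0 <= lambda.

(** In an eigenbasis the off-diagonal products vanish, leaving the sums of the [l i] and of their
    squares. *)
Lemma diagonalizable_frame :
  exists (e : (\dim {:V}).-tuple V) (l : 'I_(\dim {:V}) -> K),
  [/\ basis_of {:V} e /\ (forall i : 'I_(\dim {:V}), S e`_i = l i *: e`_i), forall i, 0 <= l i,
    scalar_integral mu (fun a => g a (w a) : K) = \sum_i l i,
    scalar_integral (mu \x mu)%E (fun p => g p.1 (w p.2) * g p.2 (w p.1) : K) =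
      \sum_i l i ^+ 2 &
    scalar_integral mu (fun b => scalar_integral mu (fun a => g a (w b) * g b (w a))) =
      \sum_i l i ^+ 2 :> K].
Proof.
have [s s_basis s_eigen] := S_diag.
have s_size : size s == \dim {:V} by rewrite (size_basis (X := in_tuple s) s_basis).
pose e := Tuple s_size; have e_basis : basis_of {:V} e by [].
have /choice[l Hl] : forall i : 'I_(\dim {:V}), exists lambda, is_eigenvector S e`_i lambda.
  by move=> i; apply: s_eigen; rewrite mem_nth// (eqP s_size).
have Se (i : 'I_(\dim {:V})) : S e`_i = l i *: e`_i by case: (Hl i).
have coordS (i j : 'I_(\dim {:V})) : coord e j (S e`_i) = l i * (i == j)%:R.
  by rewrite Se linearZ /= coord_free ?(basis_free e_basis).
have energyE : \sum_(p : 'I_(\dim {:V}) * 'I_(\dim {:V}))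
    coord e p.2 (S e`_p.1) * coord e p.1 (S e`_p.2) = \sum_i l i ^+ 2.
  rewrite -(pair_bigA _ (fun i j : 'I_(\dim {:V}) => coord e j (S e`_i) * coord e i (S e`_j)))/=.
  apply: eq_bigr => i _; rewrite (bigD1 i)//= big1 => [|j ji].
    by rewrite addr0 coordS eqxx mulr1.
  by rewrite coordS eq_sym (negPf ji) mulr0 mul0r.
exists e, l; split => //.
- by move=> i; apply: S_ge0; exists e`_i.
- rewrite (trace_integral gw e_basis); apply: eq_bigr => i _.
  by rewrite coordS eqxx mulr1.
- by rewrite (energy_integral gw e_basis).
- by rewrite (energy_iterated gw e_basis).
Qed.

(** Equality forces all eigenvalues to agree. The assumption that [S] is nonzero excludes the case
    where equality reads 0 = 0, whereas tightness asks for a nonzero scalar. *)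
Lemma tight_frame_energy : (exists x, S x <> 0) ->
  scalar_integral (mu \x mu)%E (fun p => g p.1 (w p.2) * g p.2 (w p.1) : K) =
    (\dim {:V})%:R^-1 * scalar_integral mu (fun a => g a (w a) : K) ^+ 2 <->
  tight_asf mu g w.
Proof.
move=> S_neq0; have [e [l [[e_basis Se] l_ge0 -> -> _]]] := diagonalizable_frame.
have S_lin : linear S by case: gw => _ [].
pose SL := HB.pack_for {linear V -> V} S (GRing.isLinear.Build _ _ _ _ S S_lin).
split=> [/(sqr_sum_eq l_ge0) l_eq|[_ [c c0 Sc]]].
  have [c Sc] : exists c : K, forall x, S x = c *: x.
    (* In dimension 0 there is no eigenvalue to pick, but every vector is 0. *)
    have [i0|no_i] := pselect (exists i : 'I_(\dim {:V}), True); last first.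
      exists 0 => x; rewrite (coord_basis e_basis (memvf x)) big1 => [|i _].
        by rewrite scaler0 -[S]/(SL : V -> V) raddf0.
      by case: no_i; exists i.
    case: i0 => i _; exists (l i) => x.
    rewrite {1}(coord_basis e_basis (memvf x)) -[S]/(SL : V -> V) linear_sum.
    rewrite [in RHS](coord_basis e_basis (memvf x)) scaler_sumr.
    apply: eq_bigr => j _; rewrite linearZ /=.
    by rewrite [frame_operator _ _ _ _]Se (l_eq j i) !scalerA mulrC.
  have c0 : c != 0.
    by apply/eqP => c0; case: S_neq0 => x; apply; rewrite Sc c0 scale0r.
  split; last by exists c.
  split=> //; exists (fun x => c^-1 *: x) => x; rewrite Sc scalerA.
    by rewrite mulVf// scale1r.
  by rewrite mulfV// scale1r.
(* Conversely, applying [S] to an eigenvector shows that each eigenvalue is [c]. *)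
have lc i : l i = c.
  have ei0 : e`_i != 0.
    by apply: (free_not0 (basis_free e_basis)); rewrite mem_nth// size_tuple.
  have := Se i; rewrite Sc => /eqP; rewrite -subr_eq0 -scalerBl scaler_eq0.
  by rewrite (negPf ei0) orbF subr_eq0 => /eqP.
under eq_bigr do rewrite lc; under [in RHS]eq_bigr do rewrite lc.
rewrite !sumr_const card_ord -(mulr_natl c) -(mulr_natl (c ^+ 2)) exprMn.
have [->|n0] := eqVneq ((\dim {:V})%:R : K) 0; first by rewrite invr0 !mul0r.
by rewrite [X in _ = _ * (X * _)]expr2 -mulrA mulKf.
Qed.

End DiagonalizableFrame.

(** * Welch bounds *)

Section WelchBound.
Variable R : realType.
Local Open Scope ereal_scope.

(* Both junk values of division in [\bar R] are harmless here: x / +oo = 0,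
   and x / 0 = x * +oo with x <= 0. *)
Lemma welch_bound (disp : measure_display) (T : measurableType disp)
    (nu : {measure set T -> \bar R}) (A : set T) (F : T -> R) (c : R) (s : \bar R) :
  measurable A -> (forall p, 0 <= F p)%R -> measurable_fun setT F ->
  \int[nu]_p (F p)%:E < +oo -> c%:E <= \int[nu]_p (F p)%:E ->
  0 <= s -> (forall p, ~ A p -> (F p)%:E <= s) ->
  (c%:E - \int[nu]_(p in A) (F p)%:E) / nu (~` A) <= s.
Proof.
move=> mA F0 mF Foo cF s0 Fs.
have mAC : measurable (~` A) by exact: measurableC.
have mFE D : measurable_fun D (fun p => (F p)%:E).
  by apply/measurable_EFinP; exact: measurable_funTS.
have intU : \int[nu]_p (F p)%:E =
    \int[nu]_(p in A) (F p)%:E + \int[nu]_(p in ~` A) (F p)%:E.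
  rewrite -ge0_integral_setU ?setUv//.
  - by move=> p _; rewrite lee_fin.
  - by rewrite disj_set2E setICr.
have intA0 : 0 <= \int[nu]_(p in A) (F p)%:E.
  by apply: integral_ge0 => p _; rewrite lee_fin.
have intAC0 : 0 <= \int[nu]_(p in ~` A) (F p)%:E.
  by apply: integral_ge0 => p _; rewrite lee_fin.
(* Finiteness over [A] is what allows this integral to be moved across an inequality in [\bar R]. *)
have intA_fin : \int[nu]_(p in A) (F p)%:E \is a fin_num.
  by rewrite ge0_fin_numE// (le_lt_trans _ Foo)// intU leeDl.
have x_le : c%:E - \int[nu]_(p in A) (F p)%:E <= \int[nu]_(p in ~` A) (F p)%:E.
  by rewrite leeBlDl// -intU.
have [nu0|nu0] := eqVneq (nu (~` A)) 0.
  rewrite nu0 inve0; apply: le_trans s0; apply: mule_le0_ge0 => //.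
  by apply: (le_trans x_le); rewrite null_set_integral.
have nu_gt0 : 0 < nu (~` A) by rewrite lt_def nu0 measure_ge0.
have [soo|s_fin] := eqVneq s +oo; first by rewrite soo leey.
have [nuoo|nuoo] := eqVneq (nu (~` A)) +oo; first by rewrite nuoo invey mule0.
have nu_fin : nu (~` A) \is a fin_num by rewrite ge0_fin_numE// ltey.
rewrite -(fineK nu_fin) inver gt_eqF ?fine_gt0 ?nu_gt0 ?ltey// lee_pdivrMr; last first.
  by rewrite fine_gt0// nu_gt0 ltey.
rewrite fineK//; apply: (le_trans x_le).
have s_finE : s \is a fin_num by rewrite ge0_fin_numE// ltey.
(* Off [A] the function is at most [s], so its integral is at most [s] times the measure. *)
rewrite -(fineK s_finE) -integral_cst//; apply: ge0_le_integral => //.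
- by move=> p _; rewrite lee_fin.
- by move=> p Ap; rewrite fineK//; exact: Fs.
Qed.

Lemma offdiag_sup_ge0 (T : Type) (h : T -> T -> R) : 0 <= offdiag_sup h.
Proof. by apply: ereal_sup_ubound; left. Qed.

Lemma offdiag_sup_ub (T : Type) (h : T -> T -> R) (p : T * T) :
  ~ diagonal p -> (h p.1 p.2)%:E <= offdiag_sup h.
Proof. by move=> Dp; apply: ereal_sup_ubound; right; exists p. Qed.

(** Monotonicity of [sqrte] asks for a sign of the upper bound only, so [x] may be negative. *)
Lemma sqrte_le (x s : \bar R) : 0 <= s -> x <= s * s -> sqrte x <= s.
Proof.
move=> s0 xs; rewrite -(gee0_abs s0) -sqrte_sqr lee_sqrt ?expe2//.
exact: mule_ge0.
Qed.

End WelchBound.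

Lemma power_dual_tensor (R : realType) (k : scalar_kind)
    (X : finNormedModType (scalars R k)) (m : nat) (phi : dual_space X) (x : X) :
  power_dual m phi (power_tensor m x) = phi x ^+ m :> scalars R k.
Proof. by rewrite -[LHS]/(\prod_(i < m) (phi x : scalars R k)) prodr_const card_ord. Qed.

Lemma scalar_re_natV_sqr (R : realType) (k : scalar_kind) (n : nat) (x : R) :
  scalar_re (n%:R^-1 * mkscalar k x 0 ^+ 2) = n%:R^-1 * x ^+ 2.
Proof.
case: k => //=; rewrite -[Complex x 0]/(x%:C%C).
by rewrite -(rmorph_nat (real_complex R)) -fmorphV -rmorphXn -rmorphM.
Qed.

Theorem theorem4p5 (R : realType) (k : scalar_kind)
    (disp : measure_display) (Omega : measurableType disp)
    (mu : {sigma_finite_measure set Omega -> \bar R})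
    (X : finBanachType (scalars R k)) (d m : nat)
    (f : Omega -> dual_space X) (tau : Omega -> X) :
  let mu2 := (mu \x mu)%E in
  let Delta := @diagonal Omega in
  let fm := fun a => power_dual m (f a) in
  let taum := fun a => power_tensor m (tau a) in
  let S := frame_operator mu fm taum in
  let D : nat := 'C(d + m - 1, m)%N in
  let trace : scalars R k := scalar_integral mu (fun a => f a (tau a) ^+ m) in
  let energy : scalars R k := scalar_integral mu2
    (fun p => f p.1 (tau p.2) ^+ m * f p.2 (tau p.1) ^+ m) in
  let welch : \bar R :=
    (((scalar_re (D%:R^-1 * trace ^+ 2))%:E
      - \int[mu2]_(p in Delta) (modulus (f p.1 (tau p.1)) ^+ (2 * m))%:E)
     / mu2 (~` Delta))%E in
  let welch1 : \bar R :=
    ((mu2 (~` Delta))^-1 * (mu setT ^+ 2 / (D%:R)%:E - mu2 Delta))%E in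
  let sup_prod : \bar R :=
    offdiag_sup (fun a b => modulus (f a (tau b) * f b (tau a)) ^+ m) in
  let sup_single : \bar R :=
    offdiag_sup (fun a b => modulus (f a (tau b)) ^+ m) in
  \dim {:X} = d ->
  bessel_family mu f tau ->
  measurable Delta ->
  (\int[mu2]_p (modulus (f p.1 (tau p.2) * f p.2 (tau p.1)) ^+ m)%:E < +oo)%E ->
  bessel_family mu fm taum ->
  op_diagonalizable S ->
  (forall lambda, is_eigenvalue S lambda -> 0 <= lambda) ->
  [/\ \dim {: sym_tensors X m} = D,
      [/\ energy = scalar_integral mu (fun b => scalar_integral mu
            (fun a => f a (tau b) ^+ m * f b (tau a) ^+ m)),
          energy \is Num.real,
          D%:R^-1 * trace ^+ 2 <= energy &
          D%:R^-1 * trace ^+ 2 = (\dim {: sym_tensors X m})%:R^-1 * trace ^+ 2],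
      (welch <= sup_prod)%E /\ (sqrte welch <= sup_single)%E,
      ((exists x, S x <> 0) ->
        energy = D%:R^-1 * trace ^+ 2 <-> tight_asf mu fm taum) &
      (forall a, f a (tau a) = 1) ->
        (welch1 <= sup_prod)%E /\ (sqrte welch1 <= sup_single)%E].
Proof.
move=> mu2 Delta fm taum S D trace energy welch welch1 sup_prod sup_single.
move=> dimX _ mDelta h_fin fmtaum S_diag S_ge0.
have dimD : \dim {: sym_tensors X m} = D by rewrite dim_sym_tensors dimX.
have powE a b : fm a (taum b) = f a (tau b) ^+ m :> scalars R k.
  exact: power_dual_tensor.
pose h (p : Omega * Omega) : scalars R k :=
  f p.1 (tau p.2) ^+ m * f p.2 (tau p.1) ^+ m.
(* The results on frames are used in Sym^m; these identities turn their integrands into powers of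
   the values [f a (tau b)]. *)
have traceI : (fun a => fm a (taum a) : scalars R k) = fun a => f a (tau a) ^+ m.
  by apply/funext => a; exact: powE.
have energyI : (fun p => fm p.1 (taum p.2) * fm p.2 (taum p.1) : scalars R k) = h.
  by apply/funext => p; rewrite /h -!powE.
have iterI : (fun b => scalar_integral mu
      (fun a => fm a (taum b) * fm b (taum a) : scalars R k)) =
    fun b => scalar_integral mu (fun a => f a (tau b) ^+ m * f b (tau a) ^+ m).
  apply/funext => b; congr scalar_integral; apply/funext => a.
  by rewrite -!powE.
have tightP := tight_frame_energy fmtaum S_diag S_ge0.
have [e [l [[e_basis _] l_ge0 traceE energyE iterE]]] :=
  diagonalizable_frame fmtaum S_diag S_ge0.
have trace_int := trace_integrable fmtaum e_basis.
have energy_int := energy_integrable fmtaum e_basis.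
rewrite traceI energyI dimD in tightP.
rewrite traceI in traceE trace_int.
rewrite energyI in energyE energy_int.
rewrite iterI in iterE.
have trace_ge0 : 0 <= trace by rewrite /trace traceE sumr_ge0.
have energy_ge : D%:R^-1 * trace ^+ 2 <= energy.
  by rewrite /trace /energy traceE energyE -dimD sqr_sum_le.
have h_modulus p : modulus (h p) = modulus (f p.1 (tau p.2) * f p.2 (tau p.1)) ^+ m.
  by rewrite -modulusX exprMn.
have mod_ge0 (z : scalars R k) : 0 <= modulus z by exact: modulus_ge0.
(* Serves both suprema, with [s] the first one or the square of the second. On the diagonal the
   modulus of [h] is the 2m-th power subtracted in [welch]. *)
have main_bound s : (0 <= s)%E ->
    (forall p, ~ Delta p -> (modulus (h p))%:E <= s)%E -> (welch <= s)%E.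
  move=> s0 hs; rewrite /welch.
  under eq_integral => p /set_mem pD.
    have -> : modulus (f p.1 (tau p.1)) ^+ (2 * m) = modulus (h p).
      by rewrite h_modulus modulusM -pD -expr2 exprM.
    over.
  apply: welch_bound => //.
  - exact: (measurable_modulus energy_int).
  - by under eq_integral do rewrite h_modulus.
  (* The real part of the trace term is at most that of the energy, hence at most the integral of
     the modulus. *)
  - apply: le_trans (scalar_re_integral_le energy_int).
    by rewrite lee_fin scalar_re_le.
have bound_prod : (welch <= sup_prod)%E.
  apply: main_bound; first exact: offdiag_sup_ge0.
  move=> p pD; rewrite h_modulus.
  exact: (@offdiag_sup_ub R Omega
    (fun a b => modulus (f a (tau b) * f b (tau a)) ^+ m) p pD).
have bound_single : (sqrte welch <= sup_single)%E.
  have s0 : (0 <= sup_single)%E by exact: offdiag_sup_ge0.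
  apply: sqrte_le => //; apply: main_bound; first exact: mule_ge0.
  (* Each of the two factors is bounded by the supremum, the second one at the swapped pair. *)
  move=> p pD; rewrite h_modulus modulusM exprMn EFinM.
  apply: lee_pmul; rewrite ?lee_fin ?exprn_ge0//.
    exact: (@offdiag_sup_ub R Omega (fun a b => modulus (f a (tau b)) ^+ m) p pD).
  apply: (@offdiag_sup_ub R Omega (fun a b => modulus (f a (tau b)) ^+ m) (p.2, p.1)).
  by move=> /esym.
split=> //.
- split=> //; last by rewrite dimD.
    by rewrite /energy energyE iterE.
  by rewrite /energy energyE ger0_real// sumr_ge0// => i _; rewrite exprn_ge0.
move=> f1; suff -> : welch1 = welch by [].
have re1 a : scalar_re (f a (tau a) ^+ m) = 1.
  by rewrite f1 expr1n /scalar_re; case: (k).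
(* The trace integrand is the constant 1 and is integrable, so the measure is finite. *)
have mu_fin : mu setT \is a fin_num.
  rewrite ge0_fin_numE//; have [i1 _] := trace_int.
  have [_] := integrableP _ _ _ i1.
  under eq_integral do rewrite /= re1 normr1.
  by rewrite integral_cst// mul1e.
have traceT : trace = mkscalar k (fine (mu setT)) 0.
  rewrite /trace /scalar_integral; congr mkscalar.
    rewrite /Rintegral; under eq_integral do rewrite re1.
    by rewrite integral_cst// mul1e.
  rewrite /Rintegral integral0_eq// => a _.
  by rewrite f1 expr1n /scalar_im; case: (k).
have -> : welch1 = ((mu setT ^+ 2 / (D%:R)%:E - mu2 Delta) / mu2 (~` Delta))%E.
  by rewrite /welch1 muleC.
rewrite /welch; congr (_ / _)%E; congr (_ - _)%E.
  rewrite traceT scalar_re_natV_sqr -[in LHS](fineK mu_fin) -EFin_expe.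
  (* Division by 0 has different values in [R] and in [\bar R]. If [D] is 0 the trace is an empty
     sum, so the measure of the space is 0 and both quotients vanish. *)
  have [D0|D0] := eqVneq D 0%N; last by rewrite inver pnatr_eq0 (negPf D0) -EFinM mulrC.
  suff -> : fine (mu setT) = 0 by rewrite expr0n mulr0 mul0e.
  rewrite -(scalar_re_mkscalar k (fine (mu setT)) 0) -traceT /trace traceE.
  rewrite big1 => [|i _]; first by case: (k).
  by have := ltn_ord i; rewrite [X in (_ < X)%N]dimD D0.
under eq_integral => p /set_mem pD.
  have -> : modulus (f p.1 (tau p.1)) ^+ (2 * m) = 1.
    by rewrite f1 -modulusX expr1n /modulus normr1 /scalar_re; case: (k).
  over.
by rewrite integral_cst// mul1e.
Qed.
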